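(* Let $s>1$, $\kappa>0$ and $a=2$. Then the system $$m_t=\alpha u_x-2u_xm-um_x-\kappa\rho\rho_x,\quad m=Au,\qquad \rho_t=-u\rho_x-u_x\rho,\qquad \alpha_t=0,$$ with $A=(1-D^2)^s$, can be written as the Arnold-Euler equation on the Lie algebra $C^\infty\mathfrak{g}=C^\infty(\mathbb{S}^1)\oplus C^\infty(\mathbb{S}^1)\oplus\mathbb{R}$ of the Fréchet Lie group $C^\infty G$ with the associated inner product $$\langle(u_1,\rho_1,\alpha_1),(u_2,\rho_2,\alpha_2)\rangle=\int_{\mathbb{S}^1}u_1Au_2\,dx+\kappa\int_{\mathbb{S}^1}\rho_1\rho_2\,dx-\frac12\int_{\mathbb{S}^1}\left[\alpha_2u_1+\alpha_1u_2\right]dx+\frac12\alpha_1\alpha_2,$$ where $u_i,\rho_i\in C^\infty(\mathbb{S}^1)$ and $\alpha_i\in\mathbb{R}$ for $i=1,2$. That is, a smooth curve $U(t)=(u(t),\rho(t),\alpha(t))$ in $C^\infty\mathfrak{g}$ satisfies the system $m_t=\alpha u_x-2u_xm-um_x-\kappa\rho\rho_x$ with $m=Au$, $\rho_t=-u\rho_x-u_x\rho$, $\alpha_t=0$, if and only if it satisfies $U_t=-\mathbb{B}(U,U)$, where $\mathbb{B}$ is the bilinear operator of the Arnold-Euler equation for this inner product.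
   Context: $\mathbb{S}^1=\mathbb{R}/2\pi\mathbb{Z}$ is the circle, with the measure $dx$ normalised to total mass $1$, so that $e_k(x)=e^{ikx}$, $k\in\mathbb{Z}$, is an orthonormal basis of $L_2(\mathbb{S}^1)$. $D=d/dx$, and $A=(1-D^2)^s$ is the Fourier multiplier $Ae_k=(1+k^2)^se_k$. All functions are real valued; subscripts $t,x$ denote partial derivatives. $C^\infty G=(\mathrm{Diff}^\infty(\mathbb{S}^1)\circledS C^\infty(\mathbb{S}^1))\times\mathbb{R}$, where $\mathrm{Diff}^\infty(\mathbb{S}^1)$ is the group of orientation preserving smooth diffeomorphisms of the circle and $\circledS$ is the semi-direct product whose Lie algebra $C^\infty\mathfrak{g}=C^\infty(\mathbb{S}^1)\oplus C^\infty(\mathbb{S}^1)\oplus\mathbb{R}$ has, for $U_i=(u_i,\rho_i,\alpha_i)$, $$\mathrm{ad}_{U_1}U_2=\left(u_{1,x}u_2-u_1u_{2,x},\ \rho_{1,x}u_2-\rho_{2,x}u_1,\ 0\right).$$ Arnold-Euler equation: given an inner product $\langle\cdot,\cdot\rangle$ on a Lie algebra $\mathfrak{g}$, let $\mathrm{ad}_U^\top$ denote the adjoint of $\mathrm{ad}_U$ with respect to it, i.e. $\langle U_2,\mathrm{ad}_{U_1}^\top U_3\rangle=\langle\mathrm{ad}_{U_1}U_2,U_3\rangle$ for all $U_2,U_3\in\mathfrak{g}$ (its existence for the inner product in question is part of the claim). The Arnold-Euler equation is $$U_t=-\mathbb{B}(U,U),\qquad \mathbb{B}(U_1,U_2)=\tfrac12\left(\mathrm{ad}_{U_1}^\top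 U_2+\mathrm{ad}_{U_2}^\top U_1\right);$$ it is the equation for the Eulerian velocity of geodesics of the right-invariant metric on the group induced by the inner product. *)

(* Defs.v *)
From Stdlib Require Import Reals ZArith Lra Lia FunctionalExtensionality ProofIrrelevance.
From Coquelicot Require Import Coquelicot.
Open Scope R_scope.

(** Functions on the circle [R/2piZ] are encoded as 2pi-periodic functions on [R]. *)

Definition smooth (f : R -> R) : Prop := forall n x, ex_derive_n f n x.

Definition periodic (f : R -> R) : Prop := forall x, f (x + 2 * PI) = f x.

Record Cinf : Type := mkCinf {
  Cinf_fun :> R -> R;
  Cinf_smooth : smooth Cinf_fun;
  Cinf_periodic : periodic Cinf_fun }.

Lemma Cinf_ext (f g : Cinf) : (forall x, f x = g x) -> f = g.
Proof.
destruct f as [f sf pf], g as [g sg pg]; simpl; intro H.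
assert (E : f = g) by (apply functional_extensionality; exact H).
subst g; f_equal; apply proof_irrelevance.
Qed.

Lemma smooth_ex_derive (f : R -> R) : smooth f -> forall x, ex_derive f x.
Proof. intros H x; exact (H 1%nat x). Qed.

Lemma Derive_n_S_Derive (f : R -> R) n x :
  Derive_n (Derive f) n x = Derive_n f (S n) x.
Proof.
rewrite (Derive_n_comp f n 1); now replace (n + 1)%nat with (S n) by lia.
Qed.

Lemma smooth_Derive (f : R -> R) : smooth f -> smooth (Derive f).
Proof.
intros H [|n] x; simpl; auto.
apply ex_derive_ext with (Derive_n f (S n)).
  now intro t; rewrite Derive_n_S_Derive.
exact (H (S (S n)) x).
Qed.

Lemma smooth_ext (f g : R -> R) : (forall x, f x = g x) -> smooth f -> smooth g.
Proof.
intros E H n x; apply ex_derive_n_ext with f; auto.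
Qed.

Lemma ex_derive_n_S_Derive (f : R -> R) n x :
  (forall y, ex_derive f y) ->
  ex_derive_n (Derive f) n x -> ex_derive_n f (S n) x.
Proof.
destruct n as [|n]; simpl; auto.
intros _; apply ex_derive_ext; intro t; apply (Derive_n_S_Derive f n t).
Qed.

Lemma smooth_plus (f g : R -> R) :
  smooth f -> smooth g -> smooth (fun x => f x + g x).
Proof.
intros Hf Hg n x; apply ex_derive_n_plus; exists (mkposreal 1 Rlt_0_1); auto.
Qed.

Lemma smooth_scal (a : R) (f : R -> R) : smooth f -> smooth (fun x => a * f x).
Proof. intros Hf n x; now apply ex_derive_n_scal_l. Qed.

Lemma smooth_mult (f g : R -> R) :
  smooth f -> smooth g -> smooth (fun x => f x * g x).
Proof.
assert (L : forall n k (h1 h2 : R -> R), (k <= n)%nat -> smooth h1 ->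
  smooth h2 -> forall x, ex_derive_n (fun t => h1 t * h2 t) k x).
{ induction n as [|n IH]; intros [|k] h1 h2 Hk H1 H2 x; try exact I; try lia.
  assert (D1 := smooth_ex_derive h1 H1); assert (D2 := smooth_ex_derive h2 H2).
  apply ex_derive_n_S_Derive.
    now intro y; apply (ex_derive_mult h1 h2).
  apply ex_derive_n_ext with (fun t => Derive h1 t * h2 t + h1 t * Derive h2 t).
    now intro t; symmetry; apply Derive_mult.
  apply ex_derive_n_plus; exists (mkposreal 1 Rlt_0_1); intros y _ j Hj;
    apply IH; auto using smooth_Derive; lia. }
intros Hf Hg n x; now apply (L n n).
Qed.

Definition Cinf_zero : Cinf.
Proof.
exists (fun _ => 0); [intros n x; apply ex_derive_n_const|now intro x].
Defined.

Definition Cinf_plus (f g : Cinf) : Cinf.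
Proof.
exists (fun x => f x + g x).
- now apply smooth_plus; apply Cinf_smooth.
- now intro x; rewrite 2!Cinf_periodic.
Defined.

Definition Cinf_scal (a : R) (f : Cinf) : Cinf.
Proof.
exists (fun x => a * f x).
- now apply smooth_scal; apply Cinf_smooth.
- now intro x; rewrite Cinf_periodic.
Defined.

Definition Cinf_opp (f : Cinf) : Cinf := Cinf_scal (-1) f.

Definition Cinf_mult (f g : Cinf) : Cinf.
Proof.
exists (fun x => f x * g x).
- now apply smooth_mult; apply Cinf_smooth.
- now intro x; rewrite 2!Cinf_periodic.
Defined.

Definition Cinf_D (f : Cinf) : Cinf.
Proof.
exists (Derive f).
- apply smooth_Derive, Cinf_smooth.
- intro x; unfold Derive; f_equal; apply Lim_ext; intro h.
  replace (x + 2 * PI + h) with (x + h + 2 * PI) by ring.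
  now rewrite 2!Cinf_periodic.
Defined.

Definition Cinf_AbelianMonoid_mixin : AbelianMonoid.mixin_of Cinf.
Proof.
apply (AbelianMonoid.Mixin Cinf Cinf_plus Cinf_zero); intros;
  apply Cinf_ext; intro t; simpl; ring.
Defined.

Canonical Cinf_AbelianMonoid : AbelianMonoid :=
  AbelianMonoid.Pack Cinf Cinf_AbelianMonoid_mixin Cinf.

Definition Cinf_AbelianGroup_mixin : AbelianGroup.mixin_of Cinf_AbelianMonoid.
Proof.
apply (AbelianGroup.Mixin Cinf_AbelianMonoid Cinf_opp); intros;
  apply Cinf_ext; intro t; simpl; ring.
Defined.

Canonical Cinf_AbelianGroup : AbelianGroup :=
  AbelianGroup.Pack Cinf
    (AbelianGroup.Class Cinf Cinf_AbelianMonoid_mixin Cinf_AbelianGroup_mixin)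
    Cinf.

Definition Cinf_ModuleSpace_mixin :
  ModuleSpace.mixin_of R_AbsRing Cinf_AbelianGroup.
Proof.
apply (ModuleSpace.Mixin R_AbsRing Cinf_AbelianGroup Cinf_scal); intros;
  apply Cinf_ext; intro t; simpl; unfold mult, plus, one; simpl; ring.
Defined.

Canonical Cinf_ModuleSpace : ModuleSpace R_AbsRing :=
  ModuleSpace.Pack R_AbsRing Cinf
    (ModuleSpace.Class R_AbsRing Cinf
      (AbelianGroup.class Cinf_AbelianGroup) Cinf_ModuleSpace_mixin)
    Cinf.

Record LieAlgebra : Type := mkLieAlgebra {
  lie_space :> ModuleSpace R_AbsRing;
  ad : lie_space -> lie_space -> lie_space;
  ad_plus_l : forall x y z, ad (plus x y) z = plus (ad x z) (ad y z);
  ad_scal_l : forall (a : R) x y, ad (scal a x) y = scal a (ad x y);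
  ad_plus_r : forall x y z, ad x (plus y z) = plus (ad x y) (ad x z);
  ad_scal_r : forall (a : R) x y, ad x (scal a y) = scal a (ad x y);
  ad_alternating : forall x, ad x x = zero;
  ad_jacobi : forall x y z,
    plus (plus (ad x (ad y z)) (ad y (ad z x))) (ad z (ad x y)) = zero }.

Arguments ad {l} _ _.

Record is_inner_product {V : ModuleSpace R_AbsRing} (ip : V -> V -> R) : Prop := {
  ip_sym : forall x y, ip x y = ip y x;
  ip_plus_l : forall x y z, ip (plus x y) z = ip x z + ip y z;
  ip_scal_l : forall (a : R) x y, ip (scal a x) y = a * ip x y;
  ip_pos : forall x, x <> zero -> 0 < ip x x }.

(** [adT U V] stands for [ad_U^T V]. *)
Definition is_ad_adjoint (g : LieAlgebra) (ip : g -> g -> R) (adT : g -> g -> g) : Prop :=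
  forall U1 U2 U3 : g, ip U2 (adT U1 U3) = ip (ad U1 U2) U3.

Definition arnold_euler_B {g : LieAlgebra} (adT : g -> g -> g) (U1 U2 : g) : g :=
  scal (1 / 2) (plus (adT U1 U2) (adT U2 U1)).

(** [(u, rho, alpha)] is encoded as [((u, rho), alpha)]. *)

Definition g_space : ModuleSpace R_AbsRing :=
  prod_ModuleSpace R_AbsRing
    (prod_ModuleSpace R_AbsRing Cinf_ModuleSpace Cinf_ModuleSpace) R_ModuleSpace.

Definition vel (U : g_space) : Cinf := fst (fst U).
Definition dens (U : g_space) : Cinf := snd (fst U).
Definition alph (U : g_space) : R := snd U.

Definition g_ad (U1 U2 : g_space) : g_space :=
  ((minus (Cinf_mult (Cinf_D (vel U1)) (vel U2)) (Cinf_mult (vel U1) (Cinf_D (vel U2))),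
    minus (Cinf_mult (Cinf_D (dens U1)) (vel U2)) (Cinf_mult (Cinf_D (dens U2)) (vel U1))),
   0).

Lemma Cinf_D_plus (f g : Cinf) : Cinf_D (plus f g) = plus (Cinf_D f) (Cinf_D g).
Proof.
apply Cinf_ext; intro x; apply (Derive_plus f g);
  apply smooth_ex_derive, Cinf_smooth.
Qed.

Lemma Cinf_D_scal (a : R) (f : Cinf) : Cinf_D (scal a f) = scal a (Cinf_D f).
Proof. apply Cinf_ext; intro x; apply (Derive_scal f). Qed.

Lemma Cinf_D_opp (f : Cinf) : Cinf_D (opp f) = opp (Cinf_D f).
Proof. exact (Cinf_D_scal (-1) f). Qed.

Lemma Cinf_D_mult (f g : Cinf) :
  Cinf_D (Cinf_mult f g) =
  plus (Cinf_mult (Cinf_D f) g) (Cinf_mult f (Cinf_D g)).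
Proof.
apply Cinf_ext; intro x; apply (Derive_mult f g);
  apply smooth_ex_derive, Cinf_smooth.
Qed.

Lemma g_space_ext (U V : g_space) :
  vel U = vel V -> dens U = dens V -> alph U = alph V -> U = V.
Proof.
destruct U as [[u1 r1] a1], V as [[u2 r2] a2]; unfold vel, dens, alph; simpl.
now intros -> -> ->.
Qed.

Lemma vel_ad U V : vel (g_ad U V) =
  minus (Cinf_mult (Cinf_D (vel U)) (vel V)) (Cinf_mult (vel U) (Cinf_D (vel V))).
Proof. reflexivity. Qed.

Lemma dens_ad U V : dens (g_ad U V) =
  minus (Cinf_mult (Cinf_D (dens U)) (vel V)) (Cinf_mult (Cinf_D (dens V)) (vel U)).
Proof. reflexivity. Qed.

Lemma vel_plus U V : vel (plus U V) = plus (vel U) (vel V).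
Proof. reflexivity. Qed.

Lemma dens_plus U V : dens (plus U V) = plus (dens U) (dens V).
Proof. reflexivity. Qed.

Lemma vel_scal (a : R) U : vel (scal a U) = scal a (vel U).
Proof. reflexivity. Qed.

Lemma dens_scal (a : R) U : dens (scal a U) = scal a (dens U).
Proof. reflexivity. Qed.

Ltac g_identity :=
  apply g_space_ext;
  [ | | unfold alph; simpl; unfold zero, plus, scal; simpl;
        unfold mult; simpl; ring ];
  repeat rewrite ?vel_ad, ?dens_ad, ?vel_plus, ?dens_plus, ?vel_scal, ?dens_scal;
  unfold minus;
  repeat rewrite ?Cinf_D_plus, ?Cinf_D_opp, ?Cinf_D_mult, ?Cinf_D_scal;
  apply Cinf_ext; intro t; simpl; ring.

Definition g_LieAlgebra : LieAlgebra.
Proof.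
apply (mkLieAlgebra g_space g_ad); intros; g_identity.
Defined.

(** Integral over the circle, normalised to total mass 1. *)
Definition cint (f : R -> R) : R := RInt f 0 (2 * PI) / (2 * PI).

Definition e_ (k : Z) (x : R) : C := (cos (IZR k * x), sin (IZR k * x)).

Definition fourier (u : R -> R) (k : Z) : C :=
  let f x := Cmult (RtoC (u x)) (Cconj (e_ k x)) in
  (cint (fun x => Re (f x)), cint (fun x => Im (f x))).

Definition A_term (s : R) (u : R -> R) (x : R) (k : Z) : C :=
  Cmult (RtoC (Rpower (1 + IZR k ^ 2) s)) (Cmult (fourier u k) (e_ k x)).

(** The series [sum_(k in Z) (1 + k^2)^s u^(k) e_k(x)] with the terms of index
    [k] and [-k] grouped together; for real [u] these are complex conjugate, so
    that the real part discards nothing. *)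
Definition A_op (s : R) (u : R -> R) (x : R) : R :=
  Re (A_term s u x 0) +
  Series (fun n => Re (Cplus (A_term s u x (Z.of_nat (S n)))
                             (A_term s u x (- Z.of_nat (S n))))).

Definition g_metric (s kappa : R) (U1 U2 : g_space) : R :=
  cint (fun x => vel U1 x * A_op s (vel U2) x)
  + kappa * cint (fun x => dens U1 x * dens U2 x)
  - 1 / 2 * cint (fun x => alph U2 * vel U1 x + alph U1 * vel U2 x)
  + 1 / 2 * (alph U1 * alph U2).

(** [c] has derivative [c'] at [t] for the topology of [C^oo(S^1)]: the
    difference quotients converge uniformly, as do all their [x]-derivatives. *)
Definition Cinf_is_derive (c : R -> Cinf) (t : R) (c' : Cinf) : Prop :=
  forall (n : nat) (eps : posreal),
    locally' 0 (fun h => forall x,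
      Rabs (Derive_n (minus (scal (/ h) (minus (c (t + h)) (c t))) c') n x) < eps).

Definition g_is_derive (U : R -> g_space) (t : R) (V : g_space) : Prop :=
  Cinf_is_derive (fun tau => vel (U tau)) t (vel V) /\
  Cinf_is_derive (fun tau => dens (U tau)) t (dens V) /\
  is_derive (fun tau => alph (U tau)) t (alph V).

Definition in_interval (a b : Rbar) (t : R) : Prop := Rbar_lt a t /\ Rbar_lt t b.

Definition smooth_curve (a b : Rbar) (U : R -> g_space) : Prop :=
  exists V : nat -> R -> g_space,
    (forall t, in_interval a b t -> V 0%nat t = U t) /\
    (forall n t, in_interval a b t -> g_is_derive (V n) t (V (S n) t)).

Definition system_at (s kappa : R) (U : R -> g_space) (t : R) : Prop :=
  let u := vel (U t) in
  let rho := dens (U t) in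
  let alpha := alph (U t) in
  let m := A_op s u in
  (forall x, is_derive (fun tau => A_op s (vel (U tau)) x) t
     (alpha * Derive u x - 2 * Derive u x * m x - u x * Derive m x
      - kappa * rho x * Derive rho x)) /\
  (forall x, is_derive (fun tau => dens (U tau) x) t
     (- u x * Derive rho x - Derive u x * rho x)) /\
  is_derive (fun tau => alph (U tau)) t 0.

Definition arnold_euler_at (adT : g_LieAlgebra -> g_LieAlgebra -> g_LieAlgebra)
    (U : R -> g_LieAlgebra) (t : R) : Prop :=
  g_is_derive U t (opp (arnold_euler_B adT (U t) (U t))).

(* Main.v *)
Require Import Defs.
From Stdlib Require Import Reals ZArith Lra Lia.
From Coquelicot Require Import Coquelicot.
Open Scope R_scope.

(** Write [m = A u] and
    [F(U1,U3) = 2 u1_x m3 + u1 m3_x + kappa rho1_x rho3 - alpha3 u1_x].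
    Integrating [<ad_U1 U2, U3>] by parts removes the derivatives from [u2] and
    [rho2] and leaves [int u2 F + kappa int rho2 (u1 rho3)_x]. For this to be
    [<U2, (w, sigma, beta)>] one needs [sigma = (u1 rho3)_x], then [beta = int w]
    by the coefficient of [alpha2], and [A w = F + beta / 2]; taking means, and
    since [A] preserves means, [beta = 2 int F]. Hence the adjoint exists as
    soon as [A] is invertible on smooth functions, and it is unique because the
    metric is positive definite: completing squares, the part of the metric
    that involves only [alpha] and the mean of [u] is
    [(mean u - alpha / 2)^2 + alpha^2 / 4] ([g_metric_definite],
    [g_adT_adjoint]).

    On the diagonal [F(U,U)] is a total derivative plus [u_x A u], and
    [int u_x A u = 0] because [A] is symmetric and commutes with [D]. So
    [int F(U,U) = 0] and [ad_U^T U = (A^-1 F(U,U), (u rho)_x, 0)]; applying [A]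
    to the first component of [U_t = - ad_U^T U] gives the system, and [A] being
    injective one can go back ([system_at_iff]). The derivative in time passes
    through [A] because [A] is continuous from some [C^k] to [C^0]
    ([Cinf_is_derive_A]); the smoothness of the curve upgrades the pointwise
    derivatives of the system to derivatives in [C^oo].

    All facts about [A] come from Fourier series. A real function is handled
    through its real cosine and sine coefficients. Those of a smooth function
    decay rapidly ([coef_decay]), so that multiplying them by powers of
    [1 + n^2] gives a series whose sum is again smooth ([smooth_tser]); and they
    determine the function ([coef_zero], [coef_inj]). Composition, inversion,
    linearity and commutation with [D] are then identities between
    coefficients, and symmetry and positivity are read off the Parseval-type
    series [is_series_cint_A]. *)

(** * Periodic functions and integrals over the circle *)

Definition cont (f : R -> R) : Prop := forall x, continuous f x.

Lemma cont_derive (f : R -> R) : (forall x, ex_derive f x) -> cont f.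
Proof. intros H x; apply (ex_derive_continuous f x), H. Qed.

Lemma cont_ext (f g : R -> R) : (forall x, f x = g x) -> cont f -> cont g.
Proof. intros E H x; now apply (continuous_ext f). Qed.

Lemma cont_const (c : R) : cont (fun _ => c).
Proof. intro x; apply continuous_const. Qed.

Lemma cont_plus (f g : R -> R) : cont f -> cont g -> cont (fun x => f x + g x).
Proof. intros Hf Hg x; apply (continuous_plus f g); auto. Qed.

Lemma cont_minus (f g : R -> R) : cont f -> cont g -> cont (fun x => f x - g x).
Proof. intros Hf Hg x; apply (continuous_minus f g); auto. Qed.

Lemma cont_mult (f g : R -> R) : cont f -> cont g -> cont (fun x => f x * g x).
Proof. intros Hf Hg x; apply (continuous_mult f g); auto. Qed.

Lemma cont_pow (f : R -> R) n : cont f -> cont (fun x => f x ^ n).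
Proof.
intro Hf; induction n as [|n IH]; simpl; [apply cont_const|].
now apply cont_mult.
Qed.

Lemma cont_cos (w th : R) : cont (fun x => cos (w * x + th)).
Proof. apply cont_derive; intro x; auto_derive; auto. Qed.

Lemma cont_cos0 (w : R) : cont (fun x => cos (w * x)).
Proof. apply cont_derive; intro x; auto_derive; auto. Qed.

Lemma cont_sin0 (w : R) : cont (fun x => sin (w * x)).
Proof. apply cont_derive; intro x; auto_derive; auto. Qed.

Lemma cont_Cinf (f : Cinf) : cont f.
Proof. apply cont_derive, smooth_ex_derive, Cinf_smooth. Qed.

Lemma cont_Derive (f : Cinf) : cont (Derive f).
Proof. exact (cont_Cinf (Cinf_D f)). Qed.

Create HintDb cont.
#[local] Hint Resolve cont_const cont_plus cont_minus cont_mult cont_pow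
  cont_cos cont_cos0 cont_sin0 cont_Cinf cont_Derive : cont.

Lemma cont_sum_n (f : nat -> R -> R) n :
  (forall k, cont (f k)) -> cont (fun x => sum_n (fun k => f k x) n).
Proof.
intro Hf; induction n as [|n IH].
- apply (cont_ext (f 0%nat)); auto; intro x; now rewrite sum_O.
- apply (cont_ext (fun x => sum_n (fun k => f k x) n + f (S n) x)).
    intro x; now rewrite sum_Sn.
  now apply cont_plus.
Qed.

Lemma two_PI_pos : 0 < 2 * PI.
Proof. generalize PI_RGT_0; lra. Qed.

Lemma cont_ex_RInt (f : R -> R) a b : cont f -> ex_RInt f a b.
Proof. intro Hf; apply (ex_RInt_continuous f); auto. Qed.

Lemma cint_ext (f g : R -> R) : (forall x, f x = g x) -> cint f = cint g.
Proof.
intro E; unfold cint; f_equal; apply RInt_ext; auto.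
Qed.

Lemma cint_plus (f g : R -> R) :
  cont f -> cont g -> cint (fun x => f x + g x) = cint f + cint g.
Proof.
intros Hf Hg; unfold cint.
rewrite (RInt_plus f g) by now apply cont_ex_RInt.
unfold plus; simpl; field; generalize PI_RGT_0; lra.
Qed.

Lemma cint_scal (c : R) (f : R -> R) :
  cont f -> cint (fun x => c * f x) = c * cint f.
Proof.
intro Hf; unfold cint.
rewrite (RInt_scal f _ _ c) by now apply cont_ex_RInt.
unfold scal; simpl; unfold mult; simpl; field; generalize PI_RGT_0; lra.
Qed.

Lemma cint_minus (f g : R -> R) :
  cont f -> cont g -> cint (fun x => f x - g x) = cint f - cint g.
Proof.
intros Hf Hg; rewrite (cint_ext _ (fun x => f x + (-1) * g x)) by (intro; ring).
rewrite cint_plus, cint_scal by auto with cont; ring.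
Qed.

Lemma cint_const (c : R) : cint (fun _ => c) = c.
Proof.
unfold cint; rewrite RInt_const; unfold scal; simpl; unfold mult; simpl.
field; generalize PI_RGT_0; lra.
Qed.

Lemma cint_le (f g : R -> R) :
  cont f -> cont g -> (forall x, f x <= g x) -> cint f <= cint g.
Proof.
intros Hf Hg H; unfold cint, Rdiv; apply Rmult_le_compat_r.
  generalize (Rinv_0_lt_compat _ two_PI_pos); lra.
generalize two_PI_pos; intro; apply RInt_le; auto using cont_ex_RInt; lra.
Qed.

Lemma cint_abs_le (f g : R -> R) :
  cont f -> cont g -> (forall x, Rabs (f x) <= g x) -> Rabs (cint f) <= cint g.
Proof.
intros Hf Hg H; apply Rabs_le; split.
- replace (- cint g) with (cint (fun x => (-1) * g x)).
    apply cint_le; auto with cont.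
    intro x; specialize (H x); apply Rabs_le_between in H; lra.
  rewrite cint_scal by auto; ring.
- apply cint_le; auto; intro x; specialize (H x); apply Rabs_le_between in H; lra.
Qed.

Lemma cint_derivative (F f : R -> R) :
  (forall x, is_derive F x (f x)) -> cont f -> F (2 * PI) = F 0 -> cint f = 0.
Proof.
intros HF Hf E; unfold cint.
rewrite (is_RInt_unique f 0 (2 * PI) (minus (F (2 * PI)) (F 0))).
  rewrite E; unfold minus, plus, opp; simpl; field; generalize PI_RGT_0; lra.
apply (is_RInt_derive F f); auto.
Qed.

Lemma periodic_at_2PI (f : R -> R) : periodic f -> f (2 * PI) = f 0.
Proof. intro H; rewrite <- (H 0); f_equal; ring. Qed.

Lemma Cinf_is_D (f : Cinf) x : is_derive f x (Derive f x).
Proof. apply Derive_correct, smooth_ex_derive, Cinf_smooth. Qed.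

(** The form in which integration by parts is used here: the boundary terms cancel
    by periodicity, and only the function [h] collecting them has to be found. *)
Lemma cint_eq_mod_derivative (f g : R -> R) (h : Cinf) :
  cont f -> cont g -> (forall x, f x - g x = Cinf_D h x) -> cint f = cint g.
Proof.
intros Hf Hg E; apply Rminus_diag_uniq; rewrite <- cint_minus by auto.
apply (cint_derivative h); auto with cont.
  intro x; rewrite E; apply Cinf_is_D.
apply periodic_at_2PI, Cinf_periodic.
Qed.

Lemma periodic_IZR (f : R -> R) (k : Z) x :
  periodic f -> f (x + 2 * PI * IZR k) = f x.
Proof.
intro Hf.
assert (H : forall n y, f (y + 2 * PI * INR n) = f y).
{ induction n as [|n IH]; intro y; [change (INR 0) with 0; f_equal; ring|].
  rewrite S_INR, <- (IH y), <- (Hf (y + 2 * PI * INR n)); f_equal; ring. }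
destruct k as [|p|p].
- f_equal; ring.
- now rewrite <- (positive_nat_Z p), <- INR_IZR_INZ.
- rewrite <- Pos2Z.opp_pos, opp_IZR, <- (positive_nat_Z p), <- INR_IZR_INZ.
  rewrite <- (H (Pos.to_nat p)); f_equal; ring.
Qed.

Lemma reduce_mod_2PI (a x : R) :
  exists k : Z, a <= x + 2 * PI * IZR k <= a + 2 * PI.
Proof.
generalize two_PI_pos; intro Hpi.
exists (- Int_part ((x - a) / (2 * PI)))%Z; rewrite opp_IZR.
destruct (base_Int_part ((x - a) / (2 * PI))) as [H1 H2].
set (n := IZR (Int_part _)) in *; set (q := (x - a) / (2 * PI)) in *.
assert (E : x = a + 2 * PI * q) by (unfold q; field; apply PI_neq0).
clearbody n q; assert (0 <= 2 * PI * (q - n)) by (apply Rmult_le_pos; lra).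
replace (x + 2 * PI * - n) with (a + 2 * PI * (q - n)) by (rewrite E; ring).
split; [lra|]; nra.
Qed.

Lemma Cinf_bounded (f : Cinf) : exists M, forall x, Rabs (f x) <= M.
Proof.
destruct (continuity_ab_maj (fun x => Rabs (f x)) 0 (2 * PI)) as [y [Hy _]].
- generalize two_PI_pos; lra.
- intros c _; apply (continuity_pt_comp f Rabs).
    apply continuity_pt_filterlim, cont_Cinf.
  apply Rcontinuity_abs.
- exists (Rabs (f y)); intro x.
  destruct (reduce_mod_2PI 0 x) as [k Hk].
  rewrite <- (periodic_IZR f k x) by apply Cinf_periodic.
  apply Hy; lra.
Qed.

(** * Rapidly convergent trigonometric series *)

Definition tterm (p q : nat -> R) (x : R) (n : nat) : R :=
  p n * cos (INR n * x) + q n * sin (INR n * x).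

Definition tser (p q : nat -> R) (x : R) : R := Series (tterm p q x).

(** The weight is [n + 1] and not [n] so that the constant also bounds the term of
    index 0. *)
Definition rapid (p : nat -> R) : Prop :=
  forall k : nat, exists C, forall n, (INR n + 1) ^ k * Rabs (p n) <= C.

Definition times_n (p : nat -> R) (n : nat) : R := INR n * p n.

(** Multipliers of polynomial growth preserve rapid decay: derivatives ([c n = n])
    and the multipliers of [A] are both of this kind. *)
Lemma rapid_mult (c p : nat -> R) (N : nat) (K : R) :
  (forall n, Rabs (c n) <= K * (INR n + 1) ^ N) ->
  rapid p -> rapid (fun n => c n * p n).
Proof.
intros Hc Hp k; destruct (Hp (k + N)%nat) as [C HC].
exists (K * C); intro n; specialize (HC n); specialize (Hc n).
assert (Hn : 0 <= INR n) by apply pos_INR.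
assert (P := pow_le (INR n + 1) k ltac:(lra)).
assert (Q := pow_lt (INR n + 1) N ltac:(lra)).
assert (A := Rabs_pos (p n)); assert (B := Rabs_pos (c n)).
rewrite Rabs_mult; rewrite pow_add in HC.
assert (K0 : 0 <= K) by nra.
apply Rle_trans with (K * ((INR n + 1) ^ k * (INR n + 1) ^ N * Rabs (p n))).
  replace (K * _) with ((INR n + 1) ^ k * ((K * (INR n + 1) ^ N) * Rabs (p n))) by ring.
  apply Rmult_le_compat_l; auto; apply Rmult_le_compat_r; auto.
now apply Rmult_le_compat_l.
Qed.

Lemma rapid_times_n (p : nat -> R) : rapid p -> rapid (times_n p).
Proof.
apply (rapid_mult INR p 1 1); intro n.
rewrite Rabs_pos_eq by apply pos_INR; simpl; lra.
Qed.

Lemma rapid_opp (p : nat -> R) : rapid p -> rapid (fun n => - p n).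
Proof.
intros Hp k; destruct (Hp k) as [C HC]; exists C; intro n.
now rewrite Rabs_Ropp.
Qed.

(** Comparison with a telescoping series, by [(n + 2) <= 2 (n + 1)]. *)
Lemma ex_series_inv_sq : ex_series (fun n : nat => / (INR n + 1) ^ 2).
Proof.
apply (ex_series_le (K := R_AbsRing) (V := R_CompleteNormedModule) _
  (fun n : nat => 2 * (/ (INR n + 1) - / (INR n + 2)))).
- intro n; unfold norm; simpl; unfold abs; simpl.
  assert (Hn : 0 <= INR n) by apply pos_INR.
  rewrite Rmult_1_r, Rabs_pos_eq by (left; apply Rinv_0_lt_compat; nra).
  replace (2 * (/ (INR n + 1) - / (INR n + 2)))
    with (/ ((INR n + 1) * (INR n + 1)) *
          (2 * ((INR n + 1) * / (INR n + 2)))) by (field; lra).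
  rewrite <- (Rmult_1_r (/ _)) at 1; apply Rmult_le_compat_l.
    left; apply Rinv_0_lt_compat; nra.
  apply Rmult_le_reg_r with (INR n + 2); [lra|].
  rewrite Rmult_assoc, Rmult_assoc, Rinv_l by lra; lra.
- assert (T : forall n, sum_f_R0 (fun n => 2 * (/ (INR n + 1) - / (INR n + 2))) n =
    2 - 2 / (INR n + 2)).
  { induction n as [|n IH]; [simpl; field|].
    rewrite tech5, IH, !S_INR; generalize (pos_INR n); intro; field; lra. }
  exists 2; apply is_series_Reals; intros eps Heps.
  destruct (INR_unbounded (2 / eps)) as [N HN].
  exists N; intros n Hn; unfold Rdist; rewrite T.
  replace (2 - 2 / (INR n + 2) - 2) with (- (2 / (INR n + 2))) by ring.
  assert (L : INR N <= INR n) by (apply le_INR; lia).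
  assert (P : 0 < 2 / eps) by (apply Rdiv_lt_0_compat; lra).
  rewrite Rabs_Ropp, Rabs_pos_eq by (left; apply Rdiv_lt_0_compat; lra).
  apply Rmult_lt_reg_r with (INR n + 2); [lra|].
  unfold Rdiv; rewrite Rmult_assoc, Rinv_l by lra.
  replace 2 with (2 / eps * eps) at 1 by (field; lra).
  nra.
Qed.

Definition zeta2 : R := Series (fun n : nat => / (INR n + 1) ^ 2).

Lemma ex_series_Rscal (c : R) (a : nat -> R) :
  ex_series a -> ex_series (fun n => c * a n).
Proof. exact (ex_series_scal_l (K := R_AbsRing) (V := R_NormedModule) c a). Qed.

Lemma ex_series_dominated (a b : nat -> R) :
  (forall n, Rabs (a n) <= b n) -> ex_series b -> ex_series a.
Proof. apply (ex_series_le (K := R_AbsRing) (V := R_CompleteNormedModule)). Qed.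

Lemma Series_dominated (a b : nat -> R) :
  (forall n, Rabs (a n) <= b n) -> ex_series b -> Rabs (Series a) <= Series b.
Proof.
intros H Hb; eapply Rle_trans; [apply Series_Rabs|].
  apply (ex_series_dominated _ b); auto; intro n; now rewrite Rabs_Rabsolu.
apply Series_le; auto; intro n; split; auto using Rabs_pos.
Qed.

Lemma rapid_summable (p : nat -> R) :
  rapid p -> ex_series (fun n => Rabs (p n)).
Proof.
intro Hp; destruct (Hp 2%nat) as [C HC].
apply (ex_series_dominated _ (fun n : nat => C * / (INR n + 1) ^ 2)).
  intro n; specialize (HC n); rewrite Rabs_Rabsolu.
  assert (P : 0 < (INR n + 1) ^ 2) by (apply pow_lt; generalize (pos_INR n); lra).
  apply Rmult_le_reg_l with ((INR n + 1) ^ 2); auto.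
  replace ((INR n + 1) ^ 2 * (C * / (INR n + 1) ^ 2)) with C by (field; generalize (pos_INR n); lra).
  exact HC.
apply ex_series_Rscal, ex_series_inv_sq.
Qed.

Lemma abs_cos_le (x : R) : Rabs (cos x) <= 1.
Proof. apply Rabs_le, COS_bound. Qed.

Lemma abs_sin_le (x : R) : Rabs (sin x) <= 1.
Proof. apply Rabs_le, SIN_bound. Qed.

Lemma tterm_le (p q : nat -> R) x n :
  Rabs (tterm p q x n) <= Rabs (p n) + Rabs (q n).
Proof.
unfold tterm; eapply Rle_trans; [apply Rabs_triang|].
rewrite !Rabs_mult; generalize (abs_cos_le (INR n * x)) (abs_sin_le (INR n * x)).
generalize (Rabs_pos (p n)) (Rabs_pos (q n)); nra.
Qed.

Lemma rapid_summable2 (p q : nat -> R) :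
  rapid p -> rapid q -> ex_series (fun n => Rabs (p n) + Rabs (q n)).
Proof.
intros Hp Hq.
exact (ex_series_plus _ _ (rapid_summable p Hp) (rapid_summable q Hq)).
Qed.

Lemma ex_tser (p q : nat -> R) x : rapid p -> rapid q -> ex_series (tterm p q x).
Proof.
intros Hp Hq; eapply ex_series_dominated; [apply tterm_le|].
now apply rapid_summable2.
Qed.

Lemma is_derive_tterm (p q : nat -> R) n x :
  is_derive (fun y => tterm p q y n) x (tterm (times_n q) (fun k => - times_n p k) x n).
Proof. unfold tterm, times_n; auto_derive; auto; ring. Qed.

Lemma lipschitz_of_derive (f f1 : R -> R) K :
  (forall x, is_derive f x (f1 x)) -> (forall x, Rabs (f1 x) <= K) ->
  forall x y, Rabs (f y - f x) <= K * Rabs (y - x).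
Proof.
intros Hf H1 x y; destruct (MVT_gen f x y f1) as [c [_ E]]; auto.
  intros z _; apply continuity_pt_filterlim, (ex_derive_continuous f); now exists (f1 z).
rewrite E, Rabs_mult; apply Rmult_le_compat_r; auto using Rabs_pos.
Qed.

(** A derivative estimate with explicit constant, so that it can be summed over
    the terms of a series. *)
Lemma quadratic_remainder (f f1 f2 : R -> R) K :
  (forall x, is_derive f x (f1 x)) -> (forall x, is_derive f1 x (f2 x)) ->
  (forall x, Rabs (f2 x) <= K) ->
  forall x h, Rabs (f (x + h) - f x - h * f1 x) <= K * h ^ 2.
Proof.
intros Hf Hf1 H2 x h.
destruct (MVT_gen f x (x + h) f1) as [c [Hc E]]; auto.
  intros z _; apply continuity_pt_filterlim, (ex_derive_continuous f); now exists (f1 z).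
replace (f (x + h) - f x - h * f1 x) with ((f1 c - f1 x) * h) by (rewrite E; ring).
rewrite Rabs_mult; replace (K * h ^ 2) with (K * Rabs h * Rabs h)
  by (rewrite <- (pow2_abs h); ring).
apply Rmult_le_compat_r; [apply Rabs_pos|].
eapply Rle_trans; [now apply (lipschitz_of_derive f1 f2 K)|].
apply Rmult_le_compat_l; [eapply Rle_trans; [apply Rabs_pos|apply (H2 0)]|].
revert Hc; unfold Rmin, Rmax; destruct (Rle_dec x (x + h)); intro Hc;
  unfold Rabs; repeat destruct Rcase_abs; lra.
Qed.

Lemma is_derive_of_quadratic_remainder (f : R -> R) x l K :
  (forall h, Rabs (f (x + h) - f x - h * l) <= K * h ^ 2) -> is_derive f x l.
Proof.
intro H; apply is_derive_Reals; intros eps Heps.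
assert (HK : 0 <= K) by (generalize (Rle_trans _ _ _ (Rabs_pos _) (H 1)); rewrite pow1; lra).
assert (Hd : 0 < eps / (K + 1)) by (apply Rdiv_lt_0_compat; lra).
exists (mkposreal _ Hd); simpl; intros h Hh Hlt.
replace ((f (x + h) - f x) / h - l) with ((f (x + h) - f x - h * l) / h) by (field; auto).
assert (Ha : 0 < Rabs h) by now apply Rabs_pos_lt.
rewrite Rabs_div by auto.
apply Rle_lt_trans with (K * Rabs h).
  apply Rmult_le_reg_r with (Rabs h); auto.
  unfold Rdiv; rewrite Rmult_assoc, Rinv_l by lra.
  rewrite Rmult_1_r; eapply Rle_trans; [apply H|].
  rewrite <- (pow2_abs h); lra.
apply Rle_lt_trans with ((K + 1) * Rabs h); [nra|].
replace eps with ((K + 1) * (eps / (K + 1))) by (field; lra).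
apply Rmult_lt_compat_l; lra.
Qed.

(** The [n]-th term has a remainder of order two at most
    [n^2 (|p n| + |q n|) h^2], and these bounds are summable. *)
Lemma is_derive_tser (p q : nat -> R) x :
  rapid p -> rapid q ->
  is_derive (tser p q) x (tser (times_n q) (fun n => - times_n p n) x).
Proof.
intros Hp Hq.
set (p1 := times_n q); set (q1 := fun n => - times_n p n).
set (p2 := times_n q1); set (q2 := fun n => - times_n p1 n).
assert (Hp1 : rapid p1) by now apply rapid_times_n.
assert (Hq1 : rapid q1) by now apply rapid_opp, rapid_times_n.
assert (Hp2 : rapid p2) by now apply rapid_times_n.
assert (Hq2 : rapid q2) by now apply rapid_opp, rapid_times_n.
apply is_derive_of_quadratic_remainder
  with (Series (fun n => Rabs (p2 n) + Rabs (q2 n))); intro h.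
unfold tser; rewrite <- Series_scal_l.
rewrite <- (Series_minus (tterm p q (x + h)) (tterm p q x)) by now apply ex_tser.
rewrite <- (Series_minus (fun n => tterm p q (x + h) n - tterm p q x n)
  (fun n => h * tterm p1 q1 x n)); cycle 1.
- apply (ex_series_minus (tterm p q (x + h)) (tterm p q x)); now apply ex_tser.
- now apply ex_series_Rscal, ex_tser.
- rewrite Rmult_comm, <- Series_scal_l; apply Series_dominated.
    intro n; rewrite (Rmult_comm (h ^ 2)); apply (quadratic_remainder (fun y => tterm p q y n)
      (fun y => tterm p1 q1 y n) (fun y => tterm p2 q2 y n)).
    + intro y; apply is_derive_tterm.
    + intro y; apply is_derive_tterm.
    + intro y; apply tterm_le.
  apply ex_series_Rscal, rapid_summable2; auto.
Qed.

Lemma Derive_tser (p q : nat -> R) x :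
  rapid p -> rapid q ->
  Derive (tser p q) x = tser (times_n q) (fun n => - times_n p n) x.
Proof. intros Hp Hq; apply is_derive_unique; now apply is_derive_tser. Qed.

Lemma smooth_tser (p q : nat -> R) : rapid p -> rapid q -> smooth (tser p q).
Proof.
intros Hp Hq n; revert p q Hp Hq; induction n as [|n IH]; intros p q Hp Hq x.
  exact I.
apply ex_derive_n_S_Derive.
  intro y; eexists; now apply is_derive_tser.
apply ex_derive_n_ext with (tser (times_n q) (fun n => - times_n p n)).
  intro y; now rewrite Derive_tser.
apply IH; auto using rapid_times_n, rapid_opp.
Qed.

Lemma tterm_periodic (p q : nat -> R) n : periodic (fun x => tterm p q x n).
Proof.
intro x; unfold tterm.
replace (INR n * (x + 2 * PI)) with (INR n * x + 2 * INR n * PI) by ring.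
now rewrite cos_period, sin_period.
Qed.

Lemma periodic_tser (p q : nat -> R) : periodic (tser p q).
Proof. intro x; apply Series_ext; intro n; apply (tterm_periodic p q n). Qed.

Definition tser_Cinf (p q : nat -> R) (Hp : rapid p) (Hq : rapid q) : Cinf :=
  mkCinf (tser p q) (smooth_tser p q Hp Hq) (periodic_tser p q).

(** * Fourier coefficients *)

Definition ccoef (u : R -> R) (w : R) : R := cint (fun x => u x * cos (w * x)).
Definition scoef (u : R -> R) (w : R) : R := cint (fun x => u x * sin (w * x)).

Lemma ccoef_ext u v w : (forall x, u x = v x) -> ccoef u w = ccoef v w.
Proof. intro E; apply cint_ext; intro x; now rewrite E. Qed.

Lemma scoef_ext u v w : (forall x, u x = v x) -> scoef u w = scoef v w.
Proof. intro E; apply cint_ext; intro x; now rewrite E. Qed.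

Lemma ccoef_plus u v w :
  cont u -> cont v -> ccoef (fun x => u x + v x) w = ccoef u w + ccoef v w.
Proof.
intros Hu Hv; unfold ccoef; rewrite <- cint_plus by auto with cont.
apply cint_ext; intro x; ring.
Qed.

Lemma scoef_plus u v w :
  cont u -> cont v -> scoef (fun x => u x + v x) w = scoef u w + scoef v w.
Proof.
intros Hu Hv; unfold scoef; rewrite <- cint_plus by auto with cont.
apply cint_ext; intro x; ring.
Qed.

Lemma ccoef_scal c u w : cont u -> ccoef (fun x => c * u x) w = c * ccoef u w.
Proof.
intro Hu; unfold ccoef; rewrite <- cint_scal by auto with cont.
apply cint_ext; intro x; ring.
Qed.

Lemma scoef_scal c u w : cont u -> scoef (fun x => c * u x) w = c * scoef u w.
Proof.
intro Hu; unfold scoef; rewrite <- cint_scal by auto with cont.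
apply cint_ext; intro x; ring.
Qed.

Lemma ccoef_0 u : ccoef u 0 = cint u.
Proof. apply cint_ext; intro x; rewrite Rmult_0_l, cos_0; ring. Qed.

Lemma scoef_0 u : scoef u 0 = 0.
Proof.
transitivity (cint (fun _ => 0)); [|apply cint_const]; apply cint_ext; intro x.
rewrite Rmult_0_l, sin_0; ring.
Qed.

Lemma periodic_cos_INR n : periodic (fun x => cos (INR n * x)).
Proof.
intro x; replace (INR n * (x + 2 * PI)) with (INR n * x + 2 * INR n * PI) by ring.
apply cos_period.
Qed.

Lemma periodic_sin_INR n : periodic (fun x => sin (INR n * x)).
Proof.
intro x; replace (INR n * (x + 2 * PI)) with (INR n * x + 2 * INR n * PI) by ring.
apply sin_period.
Qed.

Lemma ccoef_D (u : Cinf) n : ccoef (Cinf_D u) (INR n) = INR n * scoef u (INR n).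
Proof.
apply Rminus_diag_uniq; unfold ccoef, scoef.
rewrite <- cint_scal, <- cint_minus by auto with cont.
apply (cint_derivative (fun x => u x * cos (INR n * x))); auto with cont.
- intro x; auto_derive; [apply smooth_ex_derive, Cinf_smooth|].
  change (Derive (fun y => u y) x) with (Derive u x); simpl; ring.
- apply (periodic_at_2PI (fun x => u x * cos (INR n * x))); intro x.
  now rewrite Cinf_periodic, (periodic_cos_INR n x).
Qed.

Lemma scoef_D (u : Cinf) n : scoef (Cinf_D u) (INR n) = - (INR n * ccoef u (INR n)).
Proof.
apply Rminus_diag_uniq; unfold ccoef, scoef.
rewrite <- Ropp_mult_distr_l_reverse.
rewrite <- cint_scal, <- cint_minus by auto with cont.
apply (cint_derivative (fun x => u x * sin (INR n * x))); auto with cont.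
- intro x; auto_derive; [apply smooth_ex_derive, Cinf_smooth|].
  change (Derive (fun y => u y) x) with (Derive u x); simpl; ring.
- apply (periodic_at_2PI (fun x => u x * sin (INR n * x))); intro x.
  now rewrite Cinf_periodic, (periodic_sin_INR n x).
Qed.

Lemma coef_le_sup u w M :
  cont u -> (forall x, Rabs (u x) <= M) ->
  Rabs (ccoef u w) <= M /\ Rabs (scoef u w) <= M.
Proof.
intros Hu HM; rewrite <- (cint_const M); split;
  apply cint_abs_le; auto with cont; intro x; rewrite Rabs_mult;
  specialize (HM x); generalize (Rabs_pos (u x));
  [generalize (abs_cos_le (w * x))|generalize (abs_sin_le (w * x))]; intros; nra.
Qed.

Definition Cinf_Dn (k : nat) (u : Cinf) : Cinf := Nat.iter k Cinf_D u.

Lemma Cinf_DnE k u x : Cinf_Dn k u x = Derive_n u k x.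
Proof.
revert x; induction k as [|k IH]; intro x; [reflexivity|].
change (Derive (Cinf_Dn k u) x = Derive (Derive_n u k) x).
now apply Derive_ext.
Qed.

Lemma coef_Dn k (u : Cinf) n :
  Rabs (ccoef (Cinf_Dn k u) (INR n)) + Rabs (scoef (Cinf_Dn k u) (INR n)) =
  INR n ^ k * (Rabs (ccoef u (INR n)) + Rabs (scoef u (INR n))).
Proof.
induction k as [|k IH]; [simpl; ring|].
change (Cinf_Dn (S k) u) with (Cinf_D (Cinf_Dn k u)).
rewrite ccoef_D, scoef_D, Rabs_Ropp, !Rabs_mult, (Rabs_pos_eq (INR n)) by apply pos_INR.
simpl; rewrite Rmult_assoc, <- IH; ring.
Qed.

(** By [k] integrations by parts the coefficients of [u] of index [n > 0] are,
    up to sign and exchange of sines and cosines, [n ^ - k] times those of its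
    [k]-th derivative; the bound on [u] itself serves for the index 0. *)
Lemma coef_decay k (u : Cinf) M n :
  (forall x, Rabs (u x) <= M) -> (forall x, Rabs (Derive_n u k x) <= M) ->
  (INR n + 1) ^ k * (Rabs (ccoef u (INR n)) + Rabs (scoef u (INR n))) <= 2 ^ k * (2 * M).
Proof.
intros H0 Hk.
assert (P : 1 <= 2 ^ k) by (apply pow_R1_Rle; lra).
assert (M0 := Rle_trans _ _ _ (Rabs_pos _) (H0 0)).
destruct n as [|n].
- destruct (coef_le_sup u (INR 0) M) as [A B]; auto with cont.
  change (INR 0) with 0 in *; rewrite Rplus_0_l, pow1; nra.
- destruct (coef_le_sup (Cinf_Dn k u) (INR (S n)) M) as [A B]; auto with cont.
    intro x; rewrite Cinf_DnE; apply Hk.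
  assert (E := coef_Dn k u (S n)); set (S' := Rabs (ccoef u _) + _) in *.
  assert (S0 : 0 <= S') by (unfold S'; generalize (Rabs_pos (ccoef u (INR (S n))))
    (Rabs_pos (scoef u (INR (S n)))); lra).
  apply Rle_trans with (2 ^ k * (INR (S n) ^ k * S')).
    rewrite <- Rmult_assoc, <- Rpow_mult_distr; apply Rmult_le_compat_r; auto.
    rewrite S_INR; generalize (pos_INR n); intro; apply pow_incr; lra.
  apply Rmult_le_compat_l; lra.
Qed.

Lemma rapid_coef (u : Cinf) :
  rapid (fun n => ccoef u (INR n)) /\ rapid (fun n => scoef u (INR n)).
Proof.
assert (H : forall k, exists C, forall n, (INR n + 1) ^ k *
  (Rabs (ccoef u (INR n)) + Rabs (scoef u (INR n))) <= C).
{ intro k; destruct (Cinf_bounded u) as [M1 H1].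
  destruct (Cinf_bounded (Cinf_Dn k u)) as [M2 H2].
  exists (2 ^ k * (2 * Rmax M1 M2)); intro n; apply coef_decay; intro x.
  - eapply Rle_trans; [apply H1|apply Rmax_l].
  - rewrite <- Cinf_DnE; eapply Rle_trans; [apply H2|apply Rmax_r]. }
split; intro k; destruct (H k) as [C HC]; exists C; intro n; specialize (HC n);
  (eapply Rle_trans; [|apply HC]); apply Rmult_le_compat_l;
  try (apply pow_le; generalize (pos_INR n); lra);
  generalize (Rabs_pos (ccoef u (INR n))) (Rabs_pos (scoef u (INR n))); lra.
Qed.

Lemma cont_tser p q : rapid p -> rapid q -> cont (tser p q).
Proof. intros Hp Hq; exact (cont_Cinf (tser_Cinf p q Hp Hq)). Qed.

Lemma Series_tail_le (a b : nat -> R) n :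
  (forall k, Rabs (a k) <= b k) -> ex_series b ->
  Rabs (Series a - sum_n a n) <= Series b - sum_n b n.
Proof.
intros H Hb.
assert (Ha : ex_series a) by now apply ex_series_dominated with b.
rewrite (Series_incr_n a (S n)), (Series_incr_n b (S n)) by (auto; lia).
rewrite !sum_n_Reals; simpl pred.
replace (_ + _ - _) with (Series (fun k => a (S n + k)%nat)) by ring.
replace (_ + _ - _) with (Series (fun k => b (S n + k)%nat)) by ring.
apply Series_dominated; [intro k; apply H|].
now apply (ex_series_incr_n b (S n)).
Qed.

Lemma cont_tterm p q n : cont (fun x => tterm p q x n).
Proof. unfold tterm; auto with cont. Qed.

Lemma cint_mult_sum_n g p q n :
  cont g ->
  cint (fun x => g x * sum_n (tterm p q x) n) =
  sum_n (fun k => p k * ccoef g (INR k) + q k * scoef g (INR k)) n.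
Proof.
intro Hg.
assert (E : forall k, cint (fun x => g x * tterm p q x k) =
  p k * ccoef g (INR k) + q k * scoef g (INR k)).
{ intro k; unfold ccoef, scoef, tterm.
  rewrite <- !cint_scal, <- cint_plus by auto with cont.
  apply cint_ext; intro x; ring. }
assert (H : forall m, cont (fun x => sum_n (tterm p q x) m)).
{ intro m; apply (cont_sum_n (fun k x => tterm p q x k)); intro k; apply cont_tterm. }
induction n as [|n IH].
- rewrite sum_O, <- E; apply cint_ext; intro x; now rewrite sum_O.
- rewrite sum_Sn, <- IH, <- E; unfold plus; simpl.
  rewrite <- cint_plus by auto using cont_mult, cont_tterm.
  apply cint_ext; intro x; rewrite sum_Sn; unfold plus; simpl; ring.
Qed.

(** Uniform convergence allows integrating against [g] term by term. With [g] a
    cosine or a sine this computes coefficients, and with [tser p q] equal to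
    [A v] it is Parseval's identity. *)
Lemma is_series_cint_tser g p q M :
  cont g -> (forall x, Rabs (g x) <= M) -> rapid p -> rapid q ->
  is_series (fun n => p n * ccoef g (INR n) + q n * scoef g (INR n))
    (cint (fun x => g x * tser p q x)).
Proof.
intros Hg HM Hp Hq.
set (a := fun n => _); set (l := cint _).
set (b := fun n => Rabs (p n) + Rabs (q n)).
assert (Hb : ex_series b) by now apply rapid_summable2.
assert (M0 := Rle_trans _ _ _ (Rabs_pos _) (HM 0)).
assert (Hs : forall m, cont (fun x => sum_n (tterm p q x) m)).
{ intro m; apply (cont_sum_n (fun k x => tterm p q x k)); intro k; apply cont_tterm. }
assert (Ht : cont (tser p q)) by now apply cont_tser.
assert (D : forall n, Rabs (sum_n a n - l) <= M * (Series b - sum_n b n)).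
{ intro n; unfold a, l; rewrite <- cint_mult_sum_n by auto.
  rewrite <- cint_minus by auto using cont_mult.
  rewrite <- (cint_const (M * _)); apply cint_abs_le; auto with cont.
  intro x; rewrite <- Rmult_minus_distr_l, Rabs_mult, Rabs_minus_sym.
  apply Rmult_le_compat; auto using Rabs_pos.
  apply Series_tail_le; auto; apply tterm_le. }
assert (L : is_lim_seq (fun n => sum_n a n - l) 0).
{ apply is_lim_seq_abs_0; apply is_lim_seq_le_le with (fun _ => 0)
    (fun n => M * (Series b - sum_n b n)).
  - intro n; split; auto using Rabs_pos.
  - apply is_lim_seq_const.
  - replace 0 with (M * (Series b - Series b)) by ring.
    apply (is_lim_seq_scal_l _ M (Finite _)), is_lim_seq_minus';
      [apply is_lim_seq_const|apply (Series_correct b Hb)]. }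
change (is_lim_seq (sum_n a) l).
apply is_lim_seq_ext with (fun n => (sum_n a n - l) + l); [intro n; ring|].
replace (Finite l) with (Finite (0 + l)) by (f_equal; ring).
apply is_lim_seq_plus'; [exact L|apply is_lim_seq_const].
Qed.

(** * Orthogonality and the coefficients of a trigonometric series *)

Lemma sin_IZR_2PI (m : Z) : sin (IZR m * (2 * PI)) = 0.
Proof.
apply sin_eq_0_1; exists (2 * m)%Z; rewrite mult_IZR; ring.
Qed.

Lemma cos_IZR_2PI (m : Z) : cos (IZR m * (2 * PI)) = 1.
Proof.
replace (IZR m * (2 * PI)) with (2 * (IZR m * PI)) by ring.
rewrite cos_2a_sin, (sin_eq_0_1 (IZR m * PI)) by (now exists m); ring.
Qed.

Lemma cint_cos_IZR (m : Z) : m <> 0%Z -> cint (fun x => cos (IZR m * x)) = 0.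
Proof.
intro Hm; assert (H : IZR m <> 0) by now apply not_0_IZR.
apply (cint_derivative (fun x => sin (IZR m * x) / IZR m)); auto with cont.
- intro x; auto_derive; auto; field; auto.
- now rewrite sin_IZR_2PI, Rmult_0_r, sin_0.
Qed.

Lemma cint_sin_IZR (m : Z) : cint (fun x => sin (IZR m * x)) = 0.
Proof.
destruct (Z.eq_dec m 0) as [->|Hm].
- transitivity (cint (fun _ => 0)); [|apply cint_const].
  apply cint_ext; intro x; now rewrite Rmult_0_l, sin_0.
- assert (H : IZR m <> 0) by now apply not_0_IZR.
  apply (cint_derivative (fun x => - cos (IZR m * x) / IZR m)); auto with cont.
  + intro x; auto_derive; auto; field; auto.
  + now rewrite cos_IZR_2PI, Rmult_0_r, cos_0.
Qed.

Lemma ccoef_cos n k : ccoef (fun x => cos (INR k * x)) (INR n) =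
  if Nat.eq_dec n k then if Nat.eq_dec k 0 then 1 else 1 / 2 else 0.
Proof.
unfold ccoef; rewrite (cint_ext _ (fun x =>
  1 / 2 * cos (IZR (Z.of_nat n - Z.of_nat k) * x) +
  1 / 2 * cos (IZR (Z.of_nat n + Z.of_nat k) * x))).
2:{ intro x; rewrite minus_IZR, plus_IZR, <- !INR_IZR_INZ.
    rewrite Rmult_minus_distr_r, Rmult_plus_distr_r, cos_minus, cos_plus; field. }
rewrite cint_plus, !cint_scal by auto with cont.
destruct (Nat.eq_dec n k) as [->|Hn].
- rewrite (cint_ext (fun x => cos (IZR (Z.of_nat k - Z.of_nat k) * x)) (fun _ => 1)), cint_const.
  2:{ intro x; now rewrite Z.sub_diag, Rmult_0_l, cos_0. }
  destruct (Nat.eq_dec k 0) as [->|Hk].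
  + rewrite (cint_ext _ (fun _ => 1)), cint_const; [field|].
    intro x; simpl; now rewrite Rmult_0_l, cos_0.
  + rewrite cint_cos_IZR by lia; field.
- rewrite !cint_cos_IZR by lia; ring.
Qed.

Lemma scoef_sin n k : scoef (fun x => sin (INR k * x)) (INR n) =
  if Nat.eq_dec n k then if Nat.eq_dec k 0 then 0 else 1 / 2 else 0.
Proof.
unfold scoef; rewrite (cint_ext _ (fun x =>
  1 / 2 * cos (IZR (Z.of_nat n - Z.of_nat k) * x) -
  1 / 2 * cos (IZR (Z.of_nat n + Z.of_nat k) * x))).
2:{ intro x; rewrite minus_IZR, plus_IZR, <- !INR_IZR_INZ.
    rewrite Rmult_minus_distr_r, Rmult_plus_distr_r, cos_minus, cos_plus; field. }
rewrite cint_minus, !cint_scal by auto with cont.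
destruct (Nat.eq_dec n k) as [->|Hn].
- rewrite (cint_ext (fun x => cos (IZR (Z.of_nat k - Z.of_nat k) * x)) (fun _ => 1)), cint_const.
  2:{ intro x; now rewrite Z.sub_diag, Rmult_0_l, cos_0. }
  destruct (Nat.eq_dec k 0) as [->|Hk].
  + rewrite (cint_ext _ (fun _ => 1)), cint_const; [field|].
    intro x; simpl; now rewrite Rmult_0_l, cos_0.
  + rewrite cint_cos_IZR by lia; field.
- rewrite !cint_cos_IZR by lia; ring.
Qed.

Lemma scoef_cos n k : scoef (fun x => cos (INR k * x)) (INR n) = 0.
Proof.
unfold scoef; rewrite (cint_ext _ (fun x =>
  1 / 2 * sin (IZR (Z.of_nat n - Z.of_nat k) * x) +
  1 / 2 * sin (IZR (Z.of_nat n + Z.of_nat k) * x))).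
2:{ intro x; rewrite minus_IZR, plus_IZR, <- !INR_IZR_INZ.
    rewrite Rmult_minus_distr_r, Rmult_plus_distr_r, sin_minus, sin_plus; field. }
rewrite cint_plus, !cint_scal, !cint_sin_IZR by auto with cont; ring.
Qed.

Lemma ccoef_sin n k : ccoef (fun x => sin (INR k * x)) (INR n) = 0.
Proof.
rewrite <- (scoef_cos k n); apply cint_ext; intro x; ring.
Qed.

Lemma is_series_single (a : nat -> R) k :
  (forall n, n <> k -> a n = 0) -> is_series a (a k).
Proof.
intro H.
assert (E : forall n, sum_n a n = if le_lt_dec k n then a k else 0).
{ induction n as [|n IH].
  - rewrite sum_O; destruct (le_lt_dec k 0); [f_equal; lia|apply H; lia].
  - rewrite sum_Sn, IH; unfold plus; simpl.
    destruct (le_lt_dec k n), (le_lt_dec k (S n)); try lia.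
    + rewrite (H (S n)) by lia; ring.
    + replace (S n) with k by lia; ring.
    + rewrite (H (S n)) by lia; ring. }
apply is_series_Reals; intros eps Heps; exists k; intros n Hn.
rewrite <- sum_n_Reals, E; destruct (le_lt_dec k n); [|lia].
now rewrite Rdist_eq.
Qed.

(** The factor [1 / 2] is the mean of a squared cosine; the constant mode has none. *)
Lemma ccoef_tser p q k :
  rapid p -> rapid q ->
  ccoef (tser p q) (INR k) = p k * if Nat.eq_dec k 0 then 1 else 1 / 2.
Proof.
intros Hp Hq.
assert (H := is_series_cint_tser (fun x => cos (INR k * x)) p q 1
  (cont_cos0 _) (fun x => abs_cos_le _) Hp Hq).
apply is_series_unique in H.
unfold ccoef; rewrite (cint_ext _ (fun x => cos (INR k * x) * tser p q x)) by (intro; ring).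
rewrite <- H; clear H; apply is_series_unique.
match goal with |- is_series ?f _ => set (a := f) end.
replace (p k * _) with (a k).
  apply is_series_single; intros n Hn; unfold a.
  rewrite ccoef_cos, scoef_cos; destruct (Nat.eq_dec n k); [easy|ring].
unfold a; rewrite ccoef_cos, scoef_cos; destruct (Nat.eq_dec k k); [ring|easy].
Qed.

Lemma scoef_tser p q k :
  rapid p -> rapid q ->
  scoef (tser p q) (INR k) = q k * if Nat.eq_dec k 0 then 0 else 1 / 2.
Proof.
intros Hp Hq.
assert (H := is_series_cint_tser (fun x => sin (INR k * x)) p q 1
  (cont_sin0 _) (fun x => abs_sin_le _) Hp Hq).
apply is_series_unique in H.
unfold scoef; rewrite (cint_ext _ (fun x => sin (INR k * x) * tser p q x)) by (intro; ring).
rewrite <- H; clear H; apply is_series_unique.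
match goal with |- is_series ?f _ => set (a := f) end.
replace (q k * _) with (a k).
  apply is_series_single; intros n Hn; unfold a.
  rewrite ccoef_sin, scoef_sin; destruct (Nat.eq_dec n k); [easy|ring].
unfold a; rewrite ccoef_sin, scoef_sin; destruct (Nat.eq_dec k k); [ring|easy].
Qed.

(** * Uniqueness of Fourier coefficients *)

(** A nonnegative trigonometric polynomial whose only maximum on the circle is
    at [y]. *)
Definition kern (y x : R) : R := (1 + cos (x - y)) / 2.

Lemma cont_kern y : cont (kern y).
Proof. apply cont_derive; intro x; unfold kern; auto_derive; auto. Qed.
#[local] Hint Resolve cont_kern : cont.

Lemma kern_bounds y x : 0 <= kern y x <= 1.
Proof. unfold kern; generalize (COS_bound (x - y)); lra. Qed.

(** Expand the total derivative [d/dx (sin (x - y) kern^n)] with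
    [sin^2 = 4 kern (1 - kern)] and [cos = 2 kern - 1]. *)
Lemma cint_kern_rec y n :
  (2 * INR n + 2) * cint (fun x => kern y x ^ S n) =
  (2 * INR n + 1) * cint (fun x => kern y x ^ n).
Proof.
apply Rminus_diag_uniq.
rewrite <- !cint_scal, <- cint_minus by auto with cont.
apply (cint_derivative (fun x => sin (x - y) * kern y x ^ n)); auto with cont.
- intro x; unfold kern.
  set (c := cos (x - y)) in *; set (sn := sin (x - y)) in *.
  assert (T : sn * sn = 1 - c * c).
  { generalize (sin2_cos2 (x - y)); fold c sn; unfold Rsqr; lra. }
  auto_derive; auto; fold (x - y); replace (x + - y) with (x - y) by ring.
  fold c sn; destruct n as [|n]; [simpl; field|].
  simpl pred; rewrite <- !tech_pow_Rmult; unfold Rdiv.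
  generalize (((1 + c) * / 2) ^ n) (INR (S n)); intros P N.
  replace (sn * (1 * - sn * / 2 * (N * P))) with (- (sn * sn) * N * P / 2) by field.
  rewrite T; field.
- replace (2 * PI - y) with (- y + 2 * INR 1 * PI) by (simpl; ring).
  unfold kern; replace (2 * PI - y) with (- y + 2 * INR 1 * PI) by (simpl; ring).
  now rewrite sin_period, cos_period, Rminus_0_l.
Qed.

Lemma cint_kern_pos y n : 0 < cint (fun x => kern y x ^ n).
Proof.
induction n as [|n IH]; [simpl; rewrite cint_const; lra|].
apply Rmult_lt_reg_l with (2 * INR n + 2); [generalize (pos_INR n); lra|].
rewrite cint_kern_rec, Rmult_0_r; apply Rmult_lt_0_compat; auto.
generalize (pos_INR n); lra.
Qed.

Definition coef_vanish (f : R -> R) : Prop :=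
  forall n, ccoef f (INR n) = 0 /\ scoef f (INR n) = 0.

(** Allowing a phase turns the two families of relations into a single one, which
    is what makes the induction of the next lemma close. *)
Lemma vanishing_phase (f : Cinf) (m : Z) th : coef_vanish f ->
  cint (fun x => f x * cos (IZR m * x + th)) = 0.
Proof.
intro Hf; assert (H : forall n t, cint (fun x => f x * cos (INR n * x + t)) = 0).
{ intros n t; rewrite (cint_ext _ (fun x =>
    cos t * (f x * cos (INR n * x)) - sin t * (f x * sin (INR n * x)))).
    rewrite cint_minus, !cint_scal by auto with cont.
    fold (ccoef f (INR n)) (scoef f (INR n)).
    destruct (Hf n) as [-> ->]; ring.
  intro x; rewrite cos_plus; ring. }
destruct (Z_le_gt_dec 0 m) as [Hm|Hm].
- rewrite <- (H (Z.to_nat m) th); now rewrite INR_IZR_INZ, Z2Nat.id.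
- rewrite <- (H (Z.to_nat (- m)) (- th)); rewrite INR_IZR_INZ, Z2Nat.id, opp_IZR by lia.
  apply cint_ext; intro x; rewrite <- (cos_neg (IZR m * x + th)); do 2 f_equal; ring.
Qed.

(** The family of orthogonality relations is stable under multiplication by
    [kern y] because products of cosines are sums of cosines. *)
Lemma vanishing_kern_phase (f : Cinf) y n (m : Z) th : coef_vanish f ->
  cint (fun x => f x * kern y x ^ n * cos (IZR m * x + th)) = 0.
Proof.
intro Hf; revert m th; induction n as [|n IH]; intros m th.
- rewrite <- (vanishing_phase f m th Hf); apply cint_ext; intro x; simpl; ring.
- rewrite (cint_ext _ (fun x =>
    1 / 2 * (f x * kern y x ^ n * cos (IZR m * x + th)) +
    (1 / 4 * (f x * kern y x ^ n * cos (IZR (m + 1) * x + (th - y))) +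
     1 / 4 * (f x * kern y x ^ n * cos (IZR (m - 1) * x + (th + y)))))).
    rewrite !cint_plus, !cint_scal, !IH by auto 10 with cont; ring.
  intro x; rewrite plus_IZR, minus_IZR.
  replace ((IZR m + 1) * x + (th - y)) with ((IZR m * x + th) + (x - y)) by ring.
  replace ((IZR m - 1) * x + (th + y)) with ((IZR m * x + th) - (x - y)) by ring.
  rewrite (cos_plus (IZR m * x + th)), (cos_minus (IZR m * x + th)), <- tech_pow_Rmult.
  generalize (kern y x ^ n); intro P; unfold kern; field.
Qed.

Lemma vanishing_kern (f : Cinf) y n : coef_vanish f ->
  cint (fun x => f x * kern y x ^ n) = 0.
Proof.
intro Hf; rewrite <- (vanishing_kern_phase f y n 0 0 Hf); apply cint_ext; intro x.
rewrite Rmult_0_l, Rplus_0_l, cos_0; ring.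
Qed.

(** Near [y] continuity gives [eps]; elsewhere [1 - kern y] is bounded below, so
    that a multiple of it dominates the bounded function [f]. *)
Lemma oscillation_bound (f : Cinf) y eps : 0 < eps ->
  exists K, forall x, Rabs (f x - f y) <= eps + K * (1 - kern y x).
Proof.
intro Heps.
destruct (proj1 (continuity_pt_locally f y)
  (proj2 (continuity_pt_filterlim f y) (cont_Cinf f y)) (mkposreal eps Heps)) as [d Hd].
destruct (Cinf_bounded f) as [M HM].
assert (M0 := Rle_trans _ _ _ (Rabs_pos _) (HM 0)).
set (r := Rmin (d / 2) (PI / 2)).
assert (Hr : 0 < r <= PI / 2).
{ split; [|apply Rmin_r]; apply Rmin_glb_lt; generalize (cond_pos d) PI_RGT_0; lra. }
assert (Hrd : r < d) by (apply Rle_lt_trans with (d / 2); [apply Rmin_l|generalize (cond_pos d); lra]).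
assert (Hcr : cos r < 1) by (rewrite <- cos_0; apply cos_decreasing_1; lra).
(* At distance at least [r] one has [1 - kern y x >= (1 - cos r) / 2], while the
   oscillation of [f] is at most [2 M]. *)
exists (4 * M / (1 - cos r)); intro x.
destruct (reduce_mod_2PI (y - PI) x) as [k Hk].
assert (E1 : f (x + 2 * PI * IZR k) = f x) by (apply periodic_IZR, Cinf_periodic).
assert (E2 : kern y (x + 2 * PI * IZR k) = kern y x).
{ apply (periodic_IZR (kern y)); intro t; unfold kern.
  replace (t + 2 * PI - y) with (t - y + 2 * INR 1 * PI) by (simpl; ring).
  now rewrite cos_period. }
rewrite <- E1, <- E2; clear E1 E2; set (z := x + _) in *; clearbody z; clear x k.
assert (B := kern_bounds y z).
assert (K0 : 0 <= 4 * M / (1 - cos r)).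
{ unfold Rdiv; apply Rmult_le_pos; [lra|left; apply Rinv_0_lt_compat; lra]. }
destruct (Rlt_le_dec (Rabs (z - y)) r) as [Hz|Hz].
- assert (Q : Rabs (f z - f y) < eps) by (apply Hd; apply Rlt_trans with r; auto).
  nra.
- assert (Hcos : cos (z - y) <= cos r).
  { replace (cos (z - y)) with (cos (Rabs (z - y))).
      assert (Rabs (z - y) <= PI) by (apply Rabs_le; lra).
      apply cos_decr_1; lra.
    unfold Rabs; destruct Rcase_abs; auto; apply cos_neg. }
  apply Rle_trans with (2 * M).
    eapply Rle_trans; [apply Rabs_triang|rewrite Rabs_Ropp].
    generalize (HM z) (HM y); lra.
  assert (A : 2 * M = 4 * M / (1 - cos r) * ((1 - cos r) / 2)) by (field; lra).
  rewrite A at 1.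
  apply Rle_trans with (4 * M / (1 - cos r) * (1 - kern y z)); [|lra].
  apply Rmult_le_compat_l; auto; unfold kern; lra.
Qed.

(** The powers of [kern y] concentrate at [y]: by [cint_kern_rec], weighting by the [n]-th
    power gives [1 - kern y] the average [1 / (2 n + 2)]. Hence the average of [f],
    which is 0 by orthogonality, is close to [f y]. *)
Lemma coef_zero (f : Cinf) :
  coef_vanish f -> forall y, f y = 0.
Proof.
intros Hf y.
destruct (Req_dec (f y) 0) as [|Hy]; auto; exfalso.
assert (Ha : 0 < Rabs (f y)) by now apply Rabs_pos_lt.
destruct (oscillation_bound f y (Rabs (f y) / 2)) as [K HK]; [lra|].
destruct (INR_unbounded (K / Rabs (f y))) as [n Hn].
set (I0 := cint (fun x => kern y x ^ n)).
assert (P : 0 < I0) by apply cint_kern_pos.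
assert (R1 := cint_kern_rec y n); fold I0 in R1.
set (I1 := cint (fun x => kern y x ^ S n)) in *.
assert (L : Rabs (cint (fun x => (f x - f y) * kern y x ^ n)) <=
  cint (fun x => (Rabs (f y) / 2) * kern y x ^ n + K * (kern y x ^ n - kern y x ^ S n))).
{ apply cint_abs_le; auto 10 with cont; intro x.
  assert (Q : 0 <= kern y x ^ n) by (apply pow_le, kern_bounds).
  rewrite Rabs_mult, (Rabs_pos_eq (_ ^ n)), <- tech_pow_Rmult by auto.
  replace (_ + _) with ((Rabs (f y) / 2 + K * (1 - kern y x)) * kern y x ^ n) by ring.
  apply Rmult_le_compat_r; auto. }
rewrite cint_plus, !cint_scal, cint_minus in L by auto 10 with cont; fold I0 I1 in L.
rewrite (cint_ext _ (fun x => f x * kern y x ^ n - f y * kern y x ^ n)) in L by (intro; ring).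
rewrite cint_minus, cint_scal, vanishing_kern in L by auto with cont; fold I0 in L.
rewrite Rminus_0_l, Rabs_Ropp, Rabs_mult, (Rabs_pos_eq I0) in L by lra.
assert (N := pos_INR n).
assert (D : (I0 - I1) * (2 * INR n + 2) = I0) by nra.
assert (KN : K < Rabs (f y) * INR n).
{ apply Rmult_lt_reg_r with (/ Rabs (f y)); [now apply Rinv_0_lt_compat|].
  replace (Rabs (f y) * INR n * / Rabs (f y)) with (INR n) by (field; lra); exact Hn. }
assert (L2 : Rabs (f y) * I0 * (2 * INR n + 2) <= Rabs (f y) / 2 * I0 * (2 * INR n + 2) + K * I0).
{ rewrite <- D at 3; replace (_ + K * _) with
   ((Rabs (f y) / 2 * I0 + K * (I0 - I1)) * (2 * INR n + 2)) by ring.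
  apply Rmult_le_compat_r; lra. }
assert (K * I0 < Rabs (f y) * INR n * I0) by (apply Rmult_lt_compat_r; lra).
nra.
Qed.

Lemma coef_inj (f g : Cinf) :
  (forall n, ccoef f (INR n) = ccoef g (INR n)) ->
  (forall n, scoef f (INR n) = scoef g (INR n)) -> f = g.
Proof.
intros Hc Hs; apply Cinf_ext; intro x; apply Rminus_diag_uniq.
replace (f x - g x) with (Cinf_plus f (Cinf_scal (-1) g) x) by (simpl; ring).
apply coef_zero; intro n; split; simpl.
- rewrite (ccoef_plus f (fun x => -1 * g x)), ccoef_scal, Hc by auto with cont; ring.
- rewrite (scoef_plus f (fun x => -1 * g x)), scoef_scal, Hs by auto with cont; ring.
Qed.

(** * The Fourier multiplier on smooth functions *)

Definition lam (s : R) (n : nat) : R := Rpower (1 + INR n ^ 2) s.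

(** Number of integers of absolute value [n]. *)
Definition mult_abs (n : nat) : R := if Nat.eq_dec n 0 then 1 else 2.

Definition A_cos (s : R) (u : R -> R) (n : nat) : R :=
  mult_abs n * lam s n * ccoef u (INR n).
Definition A_sin (s : R) (u : R -> R) (n : nat) : R :=
  mult_abs n * lam s n * scoef u (INR n).

Lemma lam_0 s : lam s 0 = 1.
Proof.
unfold lam; simpl; rewrite Rmult_0_l, Rplus_0_r; unfold Rpower.
now rewrite ln_1, Rmult_0_r, exp_0.
Qed.

Lemma lam_zero n : lam 0 n = 1.
Proof. unfold lam; apply Rpower_O; generalize (pow2_ge_0 (INR n)); lra. Qed.

Lemma lam_pos s n : 0 < lam s n.
Proof. apply exp_pos. Qed.

Lemma lam_plus s t n : lam (s + t) n = lam s n * lam t n.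
Proof. apply Rpower_plus. Qed.

Lemma mult_abs_pos n : 1 <= mult_abs n <= 2.
Proof. unfold mult_abs; destruct Nat.eq_dec; lra. Qed.

Lemma multiplier_growth s : exists N, forall n,
  Rabs (mult_abs n * lam s n) <= 2 * (INR n + 1) ^ N.
Proof.
(* The exponent [2 N] comes from [1 + n^2 <= (n + 1)^2]. *)
destruct (INR_unbounded s) as [N HN]; exists (2 * N)%nat; intro n.
assert (P := pos_INR n); assert (L := lam_pos s n); assert (W := mult_abs_pos n).
assert (Q : 1 <= 1 + INR n ^ 2) by (generalize (pow2_ge_0 (INR n)); lra).
rewrite Rabs_pos_eq by (apply Rmult_le_pos; lra).
apply Rmult_le_compat; try lra.
apply Rle_trans with (Rpower (1 + INR n ^ 2) (INR N)).
  apply Rle_Rpower; lra.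
rewrite Rpower_pow, pow_mult by lra; apply pow_incr; split; [lra|simpl; nra].
Qed.

Lemma rapid_A s (u : Cinf) : rapid (A_cos s u) /\ rapid (A_sin s u).
Proof.
destruct (multiplier_growth s) as [N HN]; destruct (rapid_coef u) as [Hc Hs].
split; now apply (rapid_mult _ _ N 2 HN).
Qed.

Lemma A_termE s (u : Cinf) x k : Re (A_term s u x k) =
  Rpower (1 + IZR k ^ 2) s *
  (ccoef u (IZR k) * cos (IZR k * x) + scoef u (IZR k) * sin (IZR k * x)).
Proof.
assert (Ec : Re (fourier u k) = ccoef u (IZR k)).
{ unfold fourier, ccoef; simpl; apply cint_ext; intro y; ring. }
assert (Es : Im (fourier u k) = - scoef u (IZR k)).
{ unfold fourier, scoef; simpl.
  transitivity (cint (fun y => (-1) * (u y * sin (IZR k * y)))).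
    apply cint_ext; intro y; ring.
  rewrite cint_scal by auto with cont; ring. }
unfold A_term; destruct (fourier u k) as [a b]; simpl in Ec, Es |- *.
rewrite <- Ec, (Ropp_eq_reg b (- scoef u (IZR k)) ltac:(now rewrite Es)); ring.
Qed.

Lemma ccoef_neg u w : ccoef u (- w) = ccoef u w.
Proof.
apply cint_ext; intro x; now rewrite Ropp_mult_distr_l_reverse, cos_neg.
Qed.

Lemma scoef_neg u w : cont u -> scoef u (- w) = - scoef u w.
Proof.
intro Hu; rewrite <- (Rmult_1_l (scoef u w)), <- Ropp_mult_distr_l_reverse.
unfold scoef; rewrite <- cint_scal by auto with cont.
apply cint_ext; intro x; rewrite Ropp_mult_distr_l_reverse, sin_neg; ring.
Qed.

(** The terms of index [k] and [-k] of a real function are conjugate, so their sum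
    is twice the real part. *)
Lemma A_op_tser s (u : Cinf) x : A_op s u x = tser (A_cos s u) (A_sin s u) x.
Proof.
destruct (rapid_A s u) as [Hc Hs].
unfold A_op, tser; rewrite (Series_incr_1 (tterm _ _ x)) by now apply ex_tser.
f_equal.
- rewrite A_termE; unfold tterm, A_cos, A_sin, lam; simpl.
  change (mult_abs 0) with 1; ring.
- apply Series_ext; intro n; unfold Cplus; simpl Re.
  change (Re (A_term s u x (Z.of_nat (S n))) + Re (A_term s u x (- Z.of_nat (S n)))
    = tterm (A_cos s u) (A_sin s u) x (S n)).
  rewrite !A_termE, opp_IZR, ccoef_neg, scoef_neg by auto with cont.
  rewrite <- INR_IZR_INZ, Ropp_mult_distr_l_reverse, cos_neg, sin_neg.
  replace ((- INR (S n)) ^ 2) with (INR (S n) ^ 2) by ring.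
  unfold tterm, A_cos, A_sin, mult_abs, lam.
  destruct Nat.eq_dec; [easy|]; ring.
Qed.

Definition A_Cinf (s : R) (u : Cinf) : Cinf.
Proof.
exists (A_op s u).
- apply smooth_ext with (tser (A_cos s u) (A_sin s u)).
    intro x; now rewrite A_op_tser.
  apply smooth_tser; [apply (proj1 (rapid_A s u))|apply (proj2 (rapid_A s u))].
- intro x; rewrite !A_op_tser; apply periodic_tser.
Defined.

Lemma ccoef_A s (u : Cinf) n : ccoef (A_Cinf s u) (INR n) = lam s n * ccoef u (INR n).
Proof.
destruct (rapid_A s u) as [Hc Hs].
rewrite (ccoef_ext _ (tser (A_cos s u) (A_sin s u))) by (intro; apply A_op_tser).
rewrite ccoef_tser by auto; unfold A_cos, mult_abs; destruct Nat.eq_dec; field.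
Qed.

Lemma scoef_A s (u : Cinf) n : scoef (A_Cinf s u) (INR n) = lam s n * scoef u (INR n).
Proof.
destruct (rapid_A s u) as [Hc Hs].
rewrite (scoef_ext _ (tser (A_cos s u) (A_sin s u))) by (intro; apply A_op_tser).
rewrite scoef_tser by auto; unfold A_sin, mult_abs; destruct Nat.eq_dec as [->|]; [|field].
change (INR 0) with 0; rewrite scoef_0; ring.
Qed.

Lemma A_comp s t (u : Cinf) : A_Cinf s (A_Cinf t u) = A_Cinf (s + t) u.
Proof.
apply coef_inj; intro n.
- rewrite !ccoef_A, lam_plus; ring.
- rewrite !scoef_A, lam_plus; ring.
Qed.

(** Fourier inversion: [A_Cinf 0 u] is the sum of the Fourier series of [u]. *)
Lemma A_zero (u : Cinf) : A_Cinf 0 u = u.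
Proof.
apply coef_inj; intro n; [rewrite ccoef_A|rewrite scoef_A]; rewrite lam_zero; ring.
Qed.

Lemma A_inv_r s (u : Cinf) : A_Cinf s (A_Cinf (- s) u) = u.
Proof. now rewrite A_comp, Rplus_opp_r, A_zero. Qed.

Lemma A_inj s (u v : Cinf) : A_Cinf s u = A_Cinf s v -> u = v.
Proof.
intro E; rewrite <- (A_zero u), <- (A_zero v), <- (Rplus_opp_l s), <- !A_comp.
now rewrite E.
Qed.

Lemma A_plus s (u v : Cinf) :
  A_Cinf s (Cinf_plus u v) = Cinf_plus (A_Cinf s u) (A_Cinf s v).
Proof.
apply coef_inj; intro n.
- rewrite ccoef_A; simpl.
  rewrite (ccoef_plus u v), (ccoef_plus (A_Cinf s u) (A_Cinf s v)), !ccoef_A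
    by auto with cont; ring.
- rewrite scoef_A; simpl.
  rewrite (scoef_plus u v), (scoef_plus (A_Cinf s u) (A_Cinf s v)), !scoef_A
    by auto with cont; ring.
Qed.

Lemma A_scal s c (u : Cinf) : A_Cinf s (Cinf_scal c u) = Cinf_scal c (A_Cinf s u).
Proof.
apply coef_inj; intro n.
- rewrite ccoef_A; simpl.
  rewrite (ccoef_scal c u), (ccoef_scal c (A_Cinf s u)), ccoef_A by auto with cont; ring.
- rewrite scoef_A; simpl.
  rewrite (scoef_scal c u), (scoef_scal c (A_Cinf s u)), scoef_A by auto with cont; ring.
Qed.

Lemma A_D s (u : Cinf) : A_Cinf s (Cinf_D u) = Cinf_D (A_Cinf s u).
Proof.
apply coef_inj; intro n.
- rewrite ccoef_A, !ccoef_D, scoef_A; ring.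
- rewrite scoef_A, !scoef_D, ccoef_A; ring.
Qed.

Lemma is_series_cint_A s (u v : Cinf) :
  is_series (fun n => mult_abs n * lam s n *
      (ccoef u (INR n) * ccoef v (INR n) + scoef u (INR n) * scoef v (INR n)))
    (cint (fun x => u x * A_op s v x)).
Proof.
destruct (rapid_A s v) as [Hc Hs]; destruct (Cinf_bounded u) as [M HM].
rewrite (cint_ext _ (fun x => u x * tser (A_cos s v) (A_sin s v) x))
  by (intro; now rewrite A_op_tser).
eapply is_series_ext; [|apply (is_series_cint_tser u _ _ M); auto with cont].
intro n; simpl; unfold A_cos, A_sin; ring.
Qed.

Lemma A_sym s (u v : Cinf) :
  cint (fun x => u x * A_op s v x) = cint (fun x => v x * A_op s u x).
Proof.
rewrite <- (is_series_unique _ _ (is_series_cint_A s u v)).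
rewrite <- (is_series_unique _ _ (is_series_cint_A s v u)).
apply Series_ext; intro n; ring.
Qed.

Lemma nonneg_Series (a : nat -> R) :
  (forall n, 0 <= a n) -> ex_series a -> forall n, a n <= Series a.
Proof.
intros Ha Ex n; rewrite (Series_incr_n a (S n)) by (auto; lia); simpl pred.
assert (T : 0 <= Series (fun k => a (S n + k)%nat)).
{ assert (Z : Series (fun _ => 0) = 0).
    apply is_series_unique, (is_series_single (fun _ => 0) 0); auto.
  rewrite <- Z; apply Series_le.
    intro k; split; [lra|apply Ha].
  now apply (ex_series_incr_n a (S n)). }
assert (S0 : a n <= sum_f_R0 a n).
{ destruct n as [|n]; [simpl; lra|rewrite tech5].
  assert (0 <= sum_f_R0 a n) by (apply cond_pos_sum; auto); lra. }
lra.
Qed.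

(** The quadratic form dominates each single term of its series. The zeroth one
    is kept in the statement because the mixed term of the metric involves [u]
    through its mean only. *)
Lemma A_energy s (u : Cinf) :
  cint u ^ 2 <= cint (fun x => u x * A_op s u x) /\
  (cint (fun x => u x * A_op s u x) <= 0 -> u = Cinf_zero).
Proof.
assert (H := is_series_cint_A s u u).
set (a := fun n => _) in H; set (Q := cint _) in *.
assert (Ha : forall n, 0 <= a n).
{ intro n; unfold a; apply Rmult_le_pos; [|nra].
  generalize (mult_abs_pos n) (lam_pos s n); intros; apply Rmult_le_pos; lra. }
assert (L : forall n, a n <= Q).
{ intro n; rewrite <- (is_series_unique _ _ H); apply nonneg_Series; auto.
  now exists Q. }
split.
- replace (cint u ^ 2) with (a 0%nat); auto.
  unfold a, mult_abs; rewrite lam_0; change (INR 0) with 0; rewrite ccoef_0, scoef_0.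
  destruct Nat.eq_dec; [ring|easy].
- intros HQ; apply Cinf_ext, coef_zero; intro n.
  assert (E : a n = 0) by (generalize (Ha n) (L n); lra).
  unfold a in E; generalize (mult_abs_pos n) (lam_pos s n); intros.
  apply Rmult_integral in E; destruct E as [E|E].
    apply Rmult_integral in E; lra.
  split; nra.
Qed.

(** [A_op s] is continuous from [C^k] to [C^0] when [k] exceeds the growth of the
    multipliers by 2, which leaves the summable factor [1 / (n + 1)^2]. *)
Lemma A_op_bound s : exists (k : nat) (K : R), 0 <= K /\
  forall (u : Cinf) M, (forall x, Rabs (u x) <= M) ->
    (forall x, Rabs (Derive_n u k x) <= M) -> forall x, Rabs (A_op s u x) <= K * M.
Proof.
destruct (multiplier_growth s) as [N HN].
set (k := (N + 2)%nat); exists k, (zeta2 * (2 * (2 ^ k * 2))); split.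
- repeat apply Rmult_le_pos; try lra; [|apply pow_le; lra].
  apply Rle_trans with (/ (INR 0 + 1) ^ 2).
    simpl; left; apply Rinv_0_lt_compat; lra.
  apply (nonneg_Series (fun n => / (INR n + 1) ^ 2)); [|apply ex_series_inv_sq].
  intro n; left; apply Rinv_0_lt_compat, pow_lt; generalize (pos_INR n); lra.
- intros u M H0 Hk x; rewrite A_op_tser; unfold tser, zeta2.
  rewrite (Rmult_comm (Series _)), Rmult_assoc, (Rmult_comm (Series _) M), <- Rmult_assoc.
  rewrite <- Series_scal_l; apply Series_dominated.
  2:{ apply ex_series_Rscal, ex_series_inv_sq. }
  intro n; eapply Rle_trans; [apply tterm_le|].
  unfold A_cos, A_sin; rewrite !(Rabs_mult (mult_abs n * lam s n)).
  rewrite <- Rmult_plus_distr_l; set (S' := Rabs (ccoef _ _) + _).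
  assert (D := coef_decay k u M n H0 Hk); fold S' in D.
  assert (P : 0 < INR n + 1) by (generalize (pos_INR n); lra).
  assert (P2 : 0 < (INR n + 1) ^ 2) by now apply pow_lt.
  assert (S0 : 0 <= S').
  { unfold S'; generalize (Rabs_pos (ccoef u (INR n))) (Rabs_pos (scoef u (INR n))); lra. }
  apply Rle_trans with (2 * (INR n + 1) ^ N * S').
    apply Rmult_le_compat_r; auto.
  apply Rmult_le_reg_l with ((INR n + 1) ^ 2); auto.
  replace ((INR n + 1) ^ 2 * (2 * (2 ^ k * 2) * M * / (INR n + 1) ^ 2))
    with (2 * (2 ^ k * (2 * M))) by (field; lra).
  replace ((INR n + 1) ^ 2 * (2 * (INR n + 1) ^ N * S'))
    with (2 * ((INR n + 1) ^ k * S')) by (unfold k; rewrite pow_add; ring).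
  lra.
Qed.

(** * The metric *)

Lemma cont_A_op s (u : Cinf) : cont (A_op s u).
Proof. exact (cont_Cinf (A_Cinf s u)). Qed.
#[local] Hint Resolve cont_A_op : cont.

Lemma g_metricE s kappa (U V : g_space) : g_metric s kappa U V =
  cint (fun x => vel U x * A_op s (vel V) x) + kappa * cint (fun x => dens U x * dens V x)
  - 1 / 2 * (alph V * cint (vel U) + alph U * cint (vel V)) + 1 / 2 * (alph U * alph V).
Proof.
unfold g_metric; rewrite (cint_plus (fun x => alph V * vel U x)), !cint_scal
  by auto with cont; reflexivity.
Qed.

Lemma g_metric_sym s kappa U V : g_metric s kappa U V = g_metric s kappa V U.
Proof.
rewrite !g_metricE, (A_sym s (vel U)).
rewrite (cint_ext (fun x => dens U x * dens V x) (fun x => dens V x * dens U x))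
  by (intro; ring).
ring.
Qed.

Lemma g_metric_plus_l s kappa U V W :
  g_metric s kappa (plus U V) W = g_metric s kappa U W + g_metric s kappa V W.
Proof.
rewrite !g_metricE, vel_plus, dens_plus.
change (alph (plus U V)) with (alph U + alph V).
rewrite (cint_ext (fun x => plus (vel U) (vel V) x * A_op s (vel W) x)
  (fun x => vel U x * A_op s (vel W) x + vel V x * A_op s (vel W) x)) by (intro; simpl; ring).
rewrite (cint_ext (fun x => plus (dens U) (dens V) x * dens W x)
  (fun x => dens U x * dens W x + dens V x * dens W x)) by (intro; simpl; ring).
rewrite (cint_ext (plus (vel U) (vel V)) (fun x => vel U x + vel V x)) by reflexivity.
rewrite !cint_plus by auto with cont; ring.
Qed.

Lemma g_metric_scal_l s kappa (c : R) U W :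
  g_metric s kappa (scal c U) W = c * g_metric s kappa U W.
Proof.
rewrite !g_metricE, vel_scal, dens_scal.
change (alph (scal c U)) with (c * alph U).
rewrite (cint_ext (fun x => scal c (vel U) x * A_op s (vel W) x)
  (fun x => c * (vel U x * A_op s (vel W) x))) by (intro; simpl; ring).
rewrite (cint_ext (fun x => scal c (dens U) x * dens W x)
  (fun x => c * (dens U x * dens W x))) by (intro; simpl; ring).
rewrite (cint_ext (scal c (vel U)) (fun x => c * vel U x)) by reflexivity.
rewrite !cint_scal by auto with cont; ring.
Qed.

(** With [mu] the mean of [u], the metric is
    [(int u A u - mu^2) + kappa int rho^2 + (mu - alpha / 2)^2 + alpha^2 / 4]. *)
Lemma g_metric_definite s kappa U :
  0 < kappa -> g_metric s kappa U U <= 0 -> U = zero.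
Proof.
intros Hk; rewrite g_metricE.
destruct (A_energy s (vel U)) as [E1 E2].
destruct (A_energy 0 (dens U)) as [D1 D2].
rewrite (cint_ext (fun x => dens U x * dens U x) (fun x => dens U x * A_op 0 (dens U) x)).
2:{ intro x; change (A_op 0 (dens U) x) with (A_Cinf 0 (dens U) x); now rewrite A_zero. }
set (Q := cint (fun x => vel U x * _)) in *.
set (S := cint (fun x => dens U x * _)) in *.
set (mu := cint (vel U)) in *; set (al := alph U) in *; intro H.
assert (S0 : 0 <= S) by (generalize (pow2_ge_0 (cint (dens U))); lra).
assert (KS : 0 <= kappa * S) by (apply Rmult_le_pos; lra).
assert (P1 := pow2_ge_0 (mu - al / 2)); assert (P2 := pow2_ge_0 al).
assert (T : (Q - mu ^ 2) + kappa * S + (mu - al / 2) ^ 2 + al ^ 2 / 4 <= 0).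
{ replace (_ + _) with (Q + kappa * S - 1 / 2 * (al * mu + al * mu) + 1 / 2 * (al * al))
    by field; exact H. }
assert (A0 : al = 0) by nra.
assert (M0 : mu = 0) by (rewrite A0 in *; nra).
assert (SS : S <= 0) by nra.
apply g_space_ext.
- apply E2; rewrite M0, A0 in T; lra.
- now apply D2.
- exact A0.
Qed.

Lemma g_metric_inner_product s kappa :
  0 < kappa -> is_inner_product (g_metric s kappa).
Proof.
intro Hk; split.
- apply g_metric_sym.
- apply g_metric_plus_l.
- apply g_metric_scal_l.
- intros U HU; destruct (Rlt_le_dec 0 (g_metric s kappa U U)) as [|H]; auto.
  elim HU; exact (g_metric_definite s kappa U Hk H).
Qed.

Lemma g_metric_nondegenerate s kappa U V :
  0 < kappa -> (forall W, g_metric s kappa W U = g_metric s kappa W V) -> U = V.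
Proof.
intros Hk H.
assert (Z : plus U (scal (-1) V) = zero).
{ apply (g_metric_definite s kappa); auto; right.
  set (W := plus U (scal (-1) V)) at 1.
  rewrite g_metric_sym, g_metric_plus_l, g_metric_scal_l.
  rewrite !(g_metric_sym s kappa _ W), H; ring. }
apply g_space_ext.
- apply Cinf_ext; intro x.
  apply (f_equal (fun w => vel w x)) in Z.
  change (vel U x + -1 * vel V x = 0) in Z; lra.
- apply Cinf_ext; intro x.
  apply (f_equal (fun w => dens w x)) in Z.
  change (dens U x + -1 * dens V x = 0) in Z; lra.
- apply (f_equal alph) in Z.
  change (alph U + -1 * alph V = 0) in Z; lra.
Qed.

(** * The adjoint of [ad] *)

Definition Cinf_const (c : R) : Cinf.
Proof.
exists (fun _ => c); [intros n x; apply ex_derive_n_const|now intro x].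
Defined.

(** The Euler force: [- force U U] is the right-hand side of the equation for [m],
    and [force U V] is what remains next to [u2] when [<ad_U (u2, _, _), V>] is
    integrated by parts. *)
Definition force (s kappa : R) (U V : g_space) : Cinf :=
  let m := A_Cinf s (vel V) in
  plus (plus (scal 2 (Cinf_mult (Cinf_D (vel U)) m)) (Cinf_mult (vel U) (Cinf_D m)))
    (minus (scal kappa (Cinf_mult (Cinf_D (dens U)) (dens V)))
           (scal (alph V) (Cinf_D (vel U)))).

Lemma forceE s kappa U V x : force s kappa U V x =
  2 * Derive (vel U) x * A_op s (vel V) x + vel U x * Derive (A_op s (vel V)) x
  + kappa * Derive (dens U) x * dens V x - alph V * Derive (vel U) x.
Proof. simpl; ring. Qed.

(** Adding the mean of the force compensates the mixed term of the metric, which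
    subtracts half of the third component [2 * cint F] from the first one. *)
Definition g_adT (s kappa : R) (U V : g_space) : g_space :=
  let F := force s kappa U V in
  ((A_Cinf (- s) (plus F (Cinf_const (cint F))), Cinf_D (Cinf_mult (vel U) (dens V))),
   2 * cint F).

Lemma A_vel_adT s kappa U V x :
  A_op s (vel (g_adT s kappa U V)) x = force s kappa U V x + cint (force s kappa U V).
Proof.
exact (f_equal (fun w : Cinf => w x)
  (A_inv_r s (plus (force s kappa U V) (Cinf_const (cint (force s kappa U V)))))).
Qed.

Lemma cint_vel_adT s kappa U V :
  cint (vel (g_adT s kappa U V)) = 2 * cint (force s kappa U V).
Proof.
rewrite <- ccoef_0; change 0 with (INR 0) at 1.
unfold g_adT, vel, fst; rewrite ccoef_A, lam_0; change (INR 0) with 0.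
rewrite ccoef_0; set (F := force s kappa U V).
rewrite (cint_ext _ (fun x => F x + cint F)) by reflexivity.
rewrite cint_plus, cint_const by auto with cont; ring.
Qed.

Lemma g_adT_adjoint s kappa :
  is_ad_adjoint g_LieAlgebra (g_metric s kappa) (g_adT s kappa).
Proof.
intros U V W; change (@ad g_LieAlgebra U V) with (g_ad U V).
rewrite !g_metricE, cint_vel_adT.
rewrite (cint_ext (fun x => vel V x * A_op s (vel (g_adT s kappa U W)) x)
  (fun x => vel V x * force s kappa U W x + cint (force s kappa U W) * vel V x))
  by (intro; rewrite A_vel_adT; ring).
change (alph (g_adT s kappa U W)) with (2 * cint (force s kappa U W)).
change (alph (g_ad U V)) with 0.
change (dens (g_adT s kappa U W)) with (Cinf_D (Cinf_mult (vel U) (dens W))).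
set (c := cint (force s kappa U W)).
rewrite cint_plus, (cint_scal c) by auto with cont.
set (adV := vel (g_ad U V)); set (adR := dens (g_ad U V)).
set (S := Cinf_D (Cinf_mult (vel U) (dens W))).
assert (E : cint (fun x => vel V x * force s kappa U W x + kappa * (dens V x * S x)) =
  cint (fun x => adV x * A_op s (vel W) x + kappa * (adR x * dens W x)
                 - alph W / 2 * adV x)).
{ apply (cint_eq_mod_derivative _ _
    (minus (plus (Cinf_mult (Cinf_mult (vel U) (vel V)) (A_Cinf s (vel W)))
      (scal kappa (Cinf_mult (dens V) (Cinf_mult (vel U) (dens W)))))
      (scal (alph W / 2) (Cinf_mult (vel U) (vel V))))).
  1,2: auto 10 with cont.
  intro x.
  rewrite forceE; unfold S, adV, adR; rewrite vel_ad, dens_ad; unfold minus.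
  repeat rewrite ?Cinf_D_plus, ?Cinf_D_opp, ?Cinf_D_mult, ?Cinf_D_scal.
  simpl; field. }
rewrite cint_minus, !cint_plus, !cint_scal in E by auto 10 with cont.
lra.
Qed.

(** By symmetry of [A] and [A D = D A] the integral equals that of [u (A u)_x], and
    by parts it equals its opposite. *)
Lemma cint_D_mult_A s (u : Cinf) : cint (fun x => Derive u x * A_op s u x) = 0.
Proof.
assert (H1 : cint (fun x => Derive u x * A_op s u x) =
  cint (fun x => u x * Derive (A_op s u) x)).
{ transitivity (cint (fun x => u x * A_op s (Cinf_D u) x)).
    exact (A_sym s (Cinf_D u) u).
  apply cint_ext; intro x; f_equal.
  exact (f_equal (fun w : Cinf => w x) (A_D s u)). }
assert (C : cont (Derive (A_op s u))) by exact (cont_Derive (A_Cinf s u)).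
assert (H2 : cint (fun x => Derive u x * A_op s u x + u x * Derive (A_op s u) x) =
  cint (fun _ => 0)).
{ apply (cint_eq_mod_derivative _ _ (Cinf_mult u (A_Cinf s u))); auto with cont.
  intro x.
  rewrite Cinf_D_mult; simpl; ring. }
rewrite cint_plus, cint_const, <- H1 in H2 by auto with cont; lra.
Qed.

(** On the diagonal [force] is [(u m + kappa rho^2 / 2 - alpha u)_x + u_x m]. *)
Lemma cint_force_diag s kappa U : cint (force s kappa U U) = 0.
Proof.
rewrite <- (cint_D_mult_A s (vel U)).
apply (cint_eq_mod_derivative _ _
  (minus (plus (Cinf_mult (vel U) (A_Cinf s (vel U)))
    (scal (kappa / 2) (Cinf_mult (dens U) (dens U)))) (scal (alph U) (vel U))));
  auto with cont.
intro x.
rewrite forceE; unfold minus.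
repeat rewrite ?Cinf_D_plus, ?Cinf_D_opp, ?Cinf_D_mult, ?Cinf_D_scal.
simpl; field.
Qed.

(** * Curves of smooth functions *)

Lemma is_derive_of_quotients (f : R -> R) t l :
  (forall eps : posreal, locally' 0 (fun h => Rabs ((f (t + h) - f t) / h - l) < eps)) ->
  is_derive f t l.
Proof.
intro H; apply is_derive_Reals; intros eps Heps.
destruct (H (mkposreal eps Heps)) as [d Hd]; exists d; intros h Hh Hlt.
apply Hd; auto; change (Rabs (h + - 0) < d); now rewrite Ropp_0, Rplus_0_r.
Qed.

Lemma Cinf_is_derive_at c t c' x :
  Cinf_is_derive c t c' -> is_derive (fun tau => c tau x) t (c' x).
Proof.
intro H; apply is_derive_of_quotients; intro eps.
apply (filter_imp (F := locally' 0) _ _) with (2 := H 0%nat eps); intros h Hh.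
specialize (Hh x); simpl in Hh.
replace ((c (t + h) x - c t x) / h - c' x)
  with (/ h * (c (t + h) x + -1 * c t x) + -1 * c' x) by (unfold Rdiv; ring).
exact Hh.
Qed.

(** The error in the difference quotient of [A_op s (c tau)] is [A_op s] of the
    error in the quotient of [c], by linearity. *)
Lemma Cinf_is_derive_A s c t c' x :
  Cinf_is_derive c t c' ->
  is_derive (fun tau => A_op s (c tau) x) t (A_op s c' x).
Proof.
intro H; apply is_derive_of_quotients; intro eps.
destruct (A_op_bound s) as [k [K [HK HA]]].
assert (He : 0 < eps / (K + 1)) by (apply Rdiv_lt_0_compat; [apply cond_pos|lra]).
generalize (filter_and _ _ (H 0%nat (mkposreal _ He)) (H k (mkposreal _ He))).
apply filter_imp; intros h [H0 Hk].
set (w := minus (scal (/ h) (minus (c (t + h)) (c t))) c') in *.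
assert (E : (A_op s (c (t + h)) x - A_op s (c t) x) / h - A_op s c' x = A_op s w x).
{ change (A_op s w x) with (A_Cinf s w x).
  change w with (Cinf_plus (Cinf_scal (/ h) (Cinf_plus (c (t + h)) (Cinf_scal (-1) (c t))))
    (Cinf_scal (-1) c')).
  rewrite !A_plus, !A_scal, !A_plus, !A_scal; simpl; unfold Rdiv; ring. }
rewrite E; apply Rle_lt_trans with (K * (eps / (K + 1))).
- apply HA; intro y; left; [apply (H0 y)|apply (Hk y)].
- apply Rlt_le_trans with ((K + 1) * (eps / (K + 1))).
    apply Rmult_lt_compat_r; lra.
  right; field; lra.
Qed.

Lemma locally'_interval a b t : in_interval a b t ->
  locally' 0 (fun h => in_interval a b (t + h)).
Proof.
intros [Ha Hb]; destruct (Rbar_lt_locally a b t Ha Hb) as [d Hd].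
exists d; intros h Hh _; apply Hd.
replace (t + h - t) with (h + - 0) by ring; exact Hh.
Qed.

Lemma Cinf_is_derive_ext_loc c1 c2 t c' :
  locally' 0 (fun h => c1 (t + h) = c2 (t + h)) -> c1 t = c2 t ->
  Cinf_is_derive c1 t c' -> Cinf_is_derive c2 t c'.
Proof.
intros Hl Ht H n eps.
generalize (filter_and _ _ Hl (H n eps)); apply filter_imp; intros h [E Hh].
now rewrite <- E, <- Ht.
Qed.

Lemma g_is_derive_ext_interval a b U1 U2 t V :
  (forall r, in_interval a b r -> U1 r = U2 r) -> in_interval a b t ->
  g_is_derive U1 t V -> g_is_derive U2 t V.
Proof.
intros E Ht [H1 [H2 H3]]; assert (L := locally'_interval a b t Ht); split; [|split].
- apply (Cinf_is_derive_ext_loc (fun r => vel (U1 r))); auto; [|now rewrite E].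
  revert L; apply filter_imp; intros h Hh; now rewrite E.
- apply (Cinf_is_derive_ext_loc (fun r => dens (U1 r))); auto; [|now rewrite E].
  revert L; apply filter_imp; intros h Hh; now rewrite E.
- apply (is_derive_ext_loc (fun r => alph (U1 r))); auto.
  destruct Ht as [Ha Hb]; destruct (Rbar_lt_locally a b t Ha Hb) as [d Hd].
  exists d; intros y Hy; rewrite E; auto; apply Hd; exact Hy.
Qed.

(** The system says that the time derivative is [- ad_U^T U]: apply the
    invertible operator [A] to the first component. *)
Lemma system_at_iff s kappa U t V : g_is_derive U t V ->
  (system_at s kappa U t <-> V = opp (g_adT s kappa (U t) (U t))).
Proof.
intros [H1 [H2 H3]].
set (Z := opp (g_adT s kappa (U t) (U t))).
assert (ZA : forall x, A_op s (vel Z) x = - force s kappa (U t) (U t) x).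
{ intro x; change (A_op s (vel Z) x)
    with (A_Cinf s (Cinf_scal (-1) (vel (g_adT s kappa (U t) (U t)))) x).
  rewrite A_scal.
  change (-1 * A_op s (vel (g_adT s kappa (U t) (U t))) x = - force s kappa (U t) (U t) x).
  rewrite A_vel_adT, cint_force_diag; ring. }
assert (ZR : forall x, dens Z x = - vel (U t) x * Derive (dens (U t)) x
    - Derive (vel (U t)) x * dens (U t) x).
{ intro x; change (dens Z x) with (-1 * Cinf_D (Cinf_mult (vel (U t)) (dens (U t))) x).
  rewrite Cinf_D_mult; simpl; ring. }
assert (Zal : alph Z = 0).
{ change (alph Z) with (- (2 * cint (force s kappa (U t) (U t)))).
  rewrite cint_force_diag; ring. }
split.
- intros [S1 [S2 S3]]; apply g_space_ext.
  + apply (A_inj s), Cinf_ext; intro x.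
    change (A_op s (vel V) x = A_op s (vel Z) x); rewrite ZA, forceE.
    rewrite <- (is_derive_unique _ _ _ (Cinf_is_derive_A s _ t _ x H1)).
    rewrite (is_derive_unique _ _ _ (S1 x)); ring.
  + apply Cinf_ext; intro x; rewrite ZR.
    rewrite <- (is_derive_unique _ _ _ (Cinf_is_derive_at _ t _ x H2)).
    now rewrite (is_derive_unique _ _ _ (S2 x)).
  + rewrite Zal, <- (is_derive_unique _ _ _ H3); exact (is_derive_unique _ _ _ S3).
- intros ->; split; [|split].
  + intro x; match goal with |- is_derive _ _ ?l => replace l with (A_op s (vel Z) x) end.
      now apply Cinf_is_derive_A.
    rewrite ZA, forceE; ring.
  + intro x; rewrite <- ZR; now apply Cinf_is_derive_at.
  + now rewrite <- Zal.
Qed.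

Lemma arnold_euler_B_diag s kappa adT (U : g_LieAlgebra) :
  0 < kappa -> is_ad_adjoint g_LieAlgebra (g_metric s kappa) adT ->
  arnold_euler_B adT U U = g_adT s kappa U U.
Proof.
intros Hk Had.
assert (E : adT U U = g_adT s kappa U U).
{ apply (g_metric_nondegenerate s kappa); auto; intro W.
  rewrite (Had U W U); symmetry; apply g_adT_adjoint. }
unfold arnold_euler_B; rewrite E; set (W := g_adT s kappa U U).
change (scal (1 / 2) (plus W W : g_space) = W).
apply g_space_ext.
- apply Cinf_ext; intro x; rewrite vel_scal, vel_plus; simpl; field.
- apply Cinf_ext; intro x; rewrite dens_scal, dens_plus; simpl; field.
- change (1 / 2 * (alph W + alph W) = alph W); field.
Qed.

Theorem theorem2p1 (s kappa : R) (hs : 1 < s) (hkappa : 0 < kappa) :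
  is_inner_product (g_metric s kappa) /\
  (exists adT : g_LieAlgebra -> g_LieAlgebra -> g_LieAlgebra,
     is_ad_adjoint g_LieAlgebra (g_metric s kappa) adT) /\
  (forall adT : g_LieAlgebra -> g_LieAlgebra -> g_LieAlgebra,
     is_ad_adjoint g_LieAlgebra (g_metric s kappa) adT ->
     forall (a b : Rbar) (U : R -> g_LieAlgebra),
       smooth_curve a b U ->
       ((forall t, in_interval a b t -> system_at s kappa U t) <->
        (forall t, in_interval a b t -> arnold_euler_at adT U t))).
Proof.
split; [|split].
- now apply g_metric_inner_product.
- exists (g_adT s kappa); apply g_adT_adjoint.
- intros adT Had a b U [V [V0 V1]].
  assert (H : forall t, in_interval a b t -> g_is_derive U t (V 1%nat t)).
  { intros t Ht; apply (g_is_derive_ext_interval a b (V 0%nat)); auto. }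
  unfold arnold_euler_at; split; intros S t Ht; specialize (S t Ht).
  + rewrite (arnold_euler_B_diag s kappa) by auto.
    apply (system_at_iff s kappa U t (V 1%nat t)) in S; auto.
    change (g_is_derive U t (opp (g_adT s kappa (U t) (U t)))).
    rewrite <- S; auto.
  + rewrite (arnold_euler_B_diag s kappa) in S by auto.
    now apply (system_at_iff s kappa U t _ S).
Qed.
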